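(* Let $X$ and $T$ be diffeological spaces. Diffeological fiber bundles on $X$ with gauge group $\mathrm{Diff}(T)$, the action $\mathrm{id}:\mathrm{Diff}(T)\to\mathrm{Diff}(T)$, and fiber $T$ are exactly the usual diffeological fiber bundles with fiber $T$ on $X$. Consequently, there exists a bijective correspondence between $\check H^1(X,\mathrm{Diff}(T))$ and $\mathrm{Bund}_T(X,\mathrm{Diff}(T))\cong\mathrm{Bund}_{fiber}(X,T)$, where $\mathrm{Bund}_{fiber}(X,T)$ is the set of isomorphism classes of diffeological fiber bundles on $X$ with typical fiber $T$.
   Context: Diffeology. A domain is an open subset of some $\mathbb{R}^n$; a diffeology on a set $X$ is a set of parametrizations (maps from domains to $X$), called plots, whose images cover $X$, closed under precomposition with smooth maps between domains and under suprema of compatible families (families of plots on $n$-domains agreeing on overlaps). Smooth maps are those sending plots to plots by composition. A covering generating family of $X$ is a set $\mathcal{C}$ of plots whose images cover $X$ and such that every plot is the supremum of a compatible family of parametrizations $P\circ F$ with $P\in\mathcal{C}$, $F$ smooth between domains. A morphism of plots $Q\xrightarrow{F}P$ is a smooth map $F:\mathrm{dom}(Q)\to\mathrm{dom}(P)$ with $P\circ F=Q$. $\mathrm{Diff}(T)$ is the group of diffeomorphisms of $T$ with the standard diffeology: $P:U\to\mathrm{Diff}(T)$ is a plot iff $(r,t)\mapsto P(r)(t)$ and $(r,t)\mapsto P(r)^{-1}(t)$ are smooth on $U\times T$. Usual diffeological fiber bundles. A smooth projection is a surjective smooth map. For a plot $P:U\to X$, the pullback $P^*\pi:P^*E\to U$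 of $\pi:E\to X$ is the first projection on $P^*E=\{(u,e)\in U\times E: P(u)=\pi(e)\}$. A smooth projection $\pi:E\to X$ is a (usual) diffeological fiber bundle of fiber type $T$ if for every plot $P$ in $X$ the pullback $P^*\pi$ is locally trivial with fiber $T$, i.e. $\mathrm{dom}(P)$ has an open cover $\{U_i\}$ such that over each $U_i$ there is a diffeomorphism with $U_i\times T$ commuting with the projections to $U_i$. Isomorphisms over $X$ are diffeomorphisms commuting with the projections to $X$. In the next definitions $G=\mathrm{Diff}(T)$ and $\varrho=\mathrm{id}$; we write $\varrho g(r)(t)$ for $\varrho(g(r))(t)$. Simplices. A $1$-simplex on $\mathcal{C}$ is a diagram $P_0\xleftarrow{F_1}Q\xrightarrow{F_0}P_1$ of morphisms of plots with $P_0,P_1\in\mathcal{C}$. A $2$-simplex on $\mathcal{C}$ consists of $P_0,P_1,P_2\in\mathcal{C}$, $1$-simplices $P_0\xleftarrow{F_{2,1}}Q_2\xrightarrow{F_{2,0}}P_1$, $P_0\xleftarrow{F_{1,2}}Q_1\xrightarrow{F_{1,0}}P_2$, $P_1\xleftarrow{F_{0,2}}Q_0\xrightarrow{F_{0,1}}P_2$, a plot $Q$ and morphisms $Q\xrightarrow{F_i}Q_i$ ($i=0,1,2$) with $F_{i,j}\circ F_i=F_{j,i}\circ F_j$. Bundles with gauge group. A diffeological fiber bundle with gauge group $G$ and typical fiber $T$ on $X$ is a smooth map $\pi:E\to X$ such that there is a covering generating family $\mathcal{C}$ of $X$ along with: (a) for every $P\in\mathcal{C}$ a smooth map $\psi_P:\mathrm{dom}(P)\times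 T\to E$ such that the square $\pi\circ\psi_P=P\circ\mathrm{Pr}_1$ is a pullback in the category of diffeological spaces; (b) for each $1$-simplex a smooth map $g_{P_0\xleftarrow{F_1}Q\xrightarrow{F_0}P_1}:\mathrm{dom}(Q)\to G$ (transition) with $\psi_{P_1}(F_0(r),t)=\psi_{P_0}\big(F_1(r),\varrho g_{P_0\xleftarrow{F_1}Q\xrightarrow{F_0}P_1}(r)(t)\big)$ for all $(r,t)\in\mathrm{dom}(Q)\times T$. A refinement of $\mathcal{C}=\{P_\alpha\}_{\alpha\in I}$ is a covering generating family $\mathcal{C}'=\{P'_\beta\}_{\beta\in J}$ with a map $\lambda:J\to I$ and morphisms $P'_\beta\xrightarrow{f_\beta}P_{\lambda(\beta)}$. An isomorphism between two such bundles $\pi:E\to X$, $\pi':E'\to X$ (with data $\mathcal{C},\psi,g$ and $\mathcal{C}',\psi',g'$) is a diffeomorphism $\Phi:E\to E'$ with $\pi'\circ\Phi=\pi$, together with a common refinement $\{R_\beta\}_{\beta\in J}$ of $\mathcal{C}$ and $\mathcal{C}'$ with refinement data $P_{\lambda(\beta)}\xleftarrow{f_\beta}R_\beta\xrightarrow{f'_\beta}P'_{\lambda'(\beta)}$, such that for each $\beta$ there is a smooth map $h_\beta:\mathrm{dom}(R_\beta)\to G$ with $\Phi\circ\psi_{P_{\lambda(\beta)}}(f_\beta(r),t)=\psi'_{P'_{\lambda'(\beta)}}(f'_\beta(r),\varrho h_\beta(r)(t))$ for all $(r,t)$. $\mathrm{Bund}_T(X,G)$ is the set of isomorphism classes. Čech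 cohomology. A diffeological Čech $1$-cocycle on $\mathcal{C}$ with values in $G$ assigns to each $1$-simplex on $\mathcal{C}$ a smooth map $g_{P_0\xleftarrow{F_1}Q\xrightarrow{F_0}P_1}:\mathrm{dom}(Q)\to G$ such that for every $2$-simplex on $\mathcal{C}$ and $r\in\mathrm{dom}(Q)$, $g_{P_0\xleftarrow{F_{2,1}}Q_2\xrightarrow{F_{2,0}}P_1}(F_2(r))\,g_{P_1\xleftarrow{F_{0,2}}Q_0\xrightarrow{F_{0,1}}P_2}(F_0(r))=g_{P_0\xleftarrow{F_{1,2}}Q_1\xrightarrow{F_{1,0}}P_2}(F_1(r))$. Cocycles $g,g'$ on $\mathcal{C}$ are equivalent if there are smooth maps $h_P:\mathrm{dom}(P)\to G$ ($P\in\mathcal{C}$) with $g'_{P_0\xleftarrow{F_1}Q\xrightarrow{F_0}P_1}(r)\,h_{P_1}(F_0(r))=h_{P_0}(F_1(r))\,g_{P_0\xleftarrow{F_1}Q\xrightarrow{F_0}P_1}(r)$ for every $1$-simplex and all $r$. $H^1(X,\mathcal{C},G)$ is the set of equivalence classes. A refinement induces a map $H^1(X,\mathcal{C},G)\to H^1(X,\mathcal{C}',G)$ by assigning to a $1$-simplex $P'_{\beta_0}\xleftarrow{F_1}Q\xrightarrow{F_0}P'_{\beta_1}$ the value of $g$ at $P_{\lambda(\beta_0)}\xleftarrow{f_{\beta_0}F_1}Q\xrightarrow{f_{\beta_1}F_0}P_{\lambda(\beta_1)}$; it does not depend on the particular refinement map. $\check H^1(X,G)=\varinjlim_{\mathc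al{C}}H^1(X,\mathcal{C},G)$.
   Formalization: The identification with usual fiber bundles and Bund_T ≅ Bund_fiber are stated assuming T is nonempty whenever X is: for T empty and X nonempty, the empty map to X is a bundle with gauge group Diff(T) but is not surjective, so it is not a usual bundle. *)

(* Defs.v *)
From HB Require Import structures.
From mathcomp Require Import all_boot all_order all_algebra.
From mathcomp Require Import all_classical all_reals all_analysis.

Set Implicit Arguments.
Unset Strict Implicit.
Unset Printing Implicit Defensive.

Import Order.TTheory GRing.Theory Num.Theory numFieldNormedType.Exports.

Local Open Scope classical_set_scope.
Local Open Scope ring_scope.

(* For V of finite dimension and U open this is the usual notion of a map of
   class C^k: all iterated partial derivatives of order at most k exist and are
   continuous on U.  Only the values of f near the points of U matter. *)
Fixpoint Ck (R : realType) (V W : normedModType R) (k : nat) (U : set V)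
    (f : V -> W) : Prop :=
  if k is k'.+1 then
    (forall x, U x -> differentiable f x) /\
    (forall v, Ck k' U (fun x => 'D_v f x))
  else forall x, U x -> {for x, continuous f}.

Definition Cinfty (R : realType) (V W : normedModType R) (U : set V)
  (f : V -> W) : Prop := forall k, Ck k U f.

Section CkTheory.
Context {R : realType}.
Implicit Types (V W : normedModType R) (k : nat).

Lemma near_eq_differentiable V W (f g : V -> W) (x : V) :
  (\forall y \near x, f y = g y) -> differentiable f x -> differentiable g x.
Proof.
move=> fg /diff_locallyP[dfc dfo].
have fgx : f x = g x by apply: nbhs_singleton fg.
have H : g \o shift x = cst (g x) + 'd f x +o_ 0 id.
  apply/eqaddoP => e e0; move/eqaddoP : dfo => /(_ _ e0).
  have fg0 : \forall h \near 0, f (h + x) = g (h + x).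
    move: fg; rewrite (near_shift 0 x)/=.
    by apply: filterS => h /=; rewrite subr0.
  apply: filterS2 fg0 => h E.
  by rewrite -[(f \o _ - _) h]/(f (h + x) - (f x + _)) E fgx.
by apply/diff_locallyP; rewrite (diff_unique dfc H).
Qed.

Lemma Ck_eq V W k (U : set V) (f g : V -> W) :
  open U -> (forall x, U x -> f x = g x) -> Ck k U f -> Ck k U g.
Proof.
move=> oU; elim: k f g => [|k IH] f g fg.
  move=> cf x Ux; have fgn : \forall y \near x, f y = g y.
    by apply: filterS fg _; exact: open_nbhs_nbhs.
  move=> A; rewrite -(fg x Ux) => /(cf _ Ux A).
  by apply: filterS2 fgn => y; rewrite /= => ->.
have fgn x : U x -> \forall y \near x, f y = g y.
  by move=> Ux; apply: filterS fg _; exact: open_nbhs_nbhs.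
move=> [df Df]; split.
  by move=> x Ux; apply: near_eq_differentiable (fgn x Ux) (df x Ux).
move=> v; apply: IH (Df v) => x Ux.
exact/near_eq_derive/fgn.
Qed.

Lemma Ck_sub V W k (U U' : set V) (f : V -> W) :
  U' `<=` U -> Ck k U f -> Ck k U' f.
Proof.
move=> sU; elim: k f => [|k IH] f /=; first by move=> cf x /sU; exact: cf.
by move=> [df Df]; split=> [x /sU|v]; [exact: df|exact: IH].
Qed.

Lemma CkW V W k (U : set V) (f : V -> W) : Ck k.+1 U f -> Ck k U f.
Proof.
elim: k f => [|k IH] f.
  by move=> [df _] x Ux; apply: differentiable_continuous; exact: df.
by move=> [df Df]; split=> // v; apply: IH; exact: Df.
Qed.

Lemma Ck_local V W k (U : set V) (f : V -> W) :
  (forall x, U x -> exists2 U', U' x & Ck k U' f) -> Ck k U f.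
Proof.
elim: k f => [|k IH] f H.
  by move=> x /H[U' U'x cf]; exact: cf.
split=> [x /H[U' U'x [df _]]|v]; first exact: df.
apply: IH => x /H[U' U'x [_ Df]]; exists U' => //; exact: Df.
Qed.

Lemma Ck_cst V W k (U : set V) (c : W) : Ck k U (fun=> c).
Proof.
elim: k c => [|k IH] c; first by move=> x _; exact: cst_continuous.
split=> [x _|v]; first exact: differentiable_cst.
have -> : (fun x : V => 'D_v (fun=> c) x) = fun=> 0.
  by apply/funext => x; rewrite derive_cst.
exact: IH.
Qed.

Lemma Ck_id V k (U : set V) : Ck k U (fun x : V => x).
Proof.
case: k => [|k]; first by move=> x _; exact: cvg_id.
split=> [x _|v]; first by have [] := is_diff_id x.
have -> : (fun x : V => 'D_v (fun x : V => x) x) = fun=> v.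
  by apply/funext => x; rewrite derive_id.
exact: Ck_cst.
Qed.

Lemma CkD V W k (U : set V) (f g : V -> W) : open U ->
  Ck k U f -> Ck k U g -> Ck k U (fun x => f x + g x).
Proof.
move=> oU; elim: k f g => [|k IH] f g.
  by move=> cf cg x Ux; apply: continuousD; [exact: cf|exact: cg].
move=> [df Df] [dg Dg]; split=> [x Ux|v].
  by apply: differentiableD; [exact: df|exact: dg].
apply: Ck_eq (IH _ _ (Df v) (Dg v)) => // x Ux.
rewrite deriveD//; apply: diff_derivable; [exact: df|exact: dg].
Qed.

Lemma Ck_sum V W k (U : set V) n (f : 'I_n -> V -> W) : open U ->
  (forall i, Ck k U (f i)) -> Ck k U (fun x => \sum_(i < n) f i x).
Proof.
move=> oU; elim: n f => [|n IH] f H.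
  by apply: Ck_eq (Ck_cst k U (0 : W)) => // x _; rewrite big_ord0.
apply: Ck_eq (CkD oU (IH _ (fun i => H (widen_ord (leqnSn n) i))) (H ord_max)) => //.
by move=> x _; rewrite big_ord_recr.
Qed.

Lemma CkM V k (U : set V) (f g : V -> R) : open U ->
  Ck k U f -> Ck k U g -> Ck k U (fun x => f x * g x).
Proof.
move=> oU; elim: k f g => [|k IH] f g.
  by move=> cf cg x Ux; apply: continuousM; [exact: cf|exact: cg].
move=> Cf Cg; have [df Df] := Cf; have [dg Dg] := Cg; split=> [x Ux|v].
  by apply: differentiableM; [exact: df|exact: dg].
apply: Ck_eq (CkD oU (IH _ _ (CkW Cf) (Dg v)) (IH _ _ (CkW Cg) (Df v))) => // x Ux.
rewrite deriveM//; apply: diff_derivable; [exact: df|exact: dg].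
Qed.

Lemma Ck_coord V k m (U : set V) (f : V -> 'rV[R]_m) : open U ->
  Ck k U f <-> forall j, Ck k U (fun x => f x 0 j).
Proof.
move=> oU; split.
  move=> Cf j; elim: k f Cf => [|k IH] f.
    move=> cf x Ux.
    apply: (@continuous_comp _ _ _ f (fun M : 'rV[R]_m => M 0 j)).
      exact: cf.
    exact: coord_continuous.
  move=> [df Df]; split=> [x Ux|v].
    apply: (@differentiable_comp _ _ _ _ f (fun M : 'rV[R]_m => M 0 j)).
      exact: df.
    exact: differentiable_coord.
  apply: Ck_eq (IH _ (Df v)) => // x Ux.
  by rewrite derive_mx ?mxE//; exact/diff_derivable/df.
have key : f = \sum_(j < m) (fun x => f x 0 j *: 'e_j).
  apply/funext => x; rewrite fct_sumE.
  exact: row_sum_delta.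
elim: k f key => [|k IH] f key H.
  move=> x Ux.
  rewrite key; apply: (@big_ind _ (fun f => {for x, continuous f})).
  - exact: cst_continuous.
  - by move=> g h cg ch; exact: continuousD.
  - move=> j _; apply: continuousZr_tmp; exact: H.
have df x : U x -> differentiable f x.
  move=> Ux; rewrite key; apply: differentiable_sum => j.
  by apply: differentiableZl; have [dj _] := H j; exact: dj.
split=> // v; apply: IH.
  apply/funext => x; rewrite fct_sumE; exact: row_sum_delta.
move=> j; have [_ /(_ v)] := H j; apply: Ck_eq => // x Ux.
by rewrite derive_mx ?mxE//; exact/diff_derivable/df.
Qed.

Lemma Ck_comp_num V k m (U : set V) (U' : set 'rV[R]_m) (f : V -> 'rV[R]_m)
    (g : 'rV[R]_m -> R) : open U ->
  (forall x, U x -> U' (f x)) -> Ck k U f -> Ck k U' g ->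
  Ck k U (g \o f).
Proof.
move=> oU fU; elim: k f g fU => [|k IH] f g fU.
  by move=> cf cg x Ux; apply: continuous_comp; [exact: cf|exact/cg/fU].
move=> Cf [dg Dg]; have [df Df] := Cf; split=> [x Ux|v].
  by apply: differentiable_comp; [exact: df|exact/dg/fU].
pose S x := \sum_(j < m) ('D_v f x) 0 j * ('D_('e_j) g \o f) x.
have CS : Ck k U S.
  apply: Ck_sum => // j; apply: CkM => //.
    exact: ((Ck_coord k _ oU).1 (Df v) j).
  exact: (IH f _ fU (CkW Cf) (Dg 'e_j)).
apply: Ck_eq CS => // x Ux; rewrite /S.
have dfx := df _ Ux; have dgx := dg _ (fU _ Ux).
rewrite (deriveE v (differentiable_comp dfx dgx)) diff_comp//= -(deriveE v dfx).
rewrite [in RHS](row_sum_delta ('D_v f x)) linear_sum/=.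
by apply: eq_bigr => j _; rewrite linearZ/= (deriveE _ dgx).
Qed.

Lemma Ck_comp V k m p (U : set V) (U' : set 'rV[R]_m) (f : V -> 'rV[R]_m)
    (g : 'rV[R]_m -> 'rV[R]_p) : open U -> open U' ->
  (forall x, U x -> U' (f x)) -> Ck k U f -> Ck k U' g ->
  Ck k U (g \o f).
Proof.
move=> oU oU' fU Cf /(Ck_coord k _ oU') Cg; apply/(Ck_coord k _ oU) => j.
exact: (Ck_comp_num oU fU Cf (Cg j)).
Qed.

End CkTheory.

Section Diffeology.
Variable R : realType.

Record domain (n : nat) := Domain {
  dom_set :> set 'rV[R]_n ;
  dom_open : open dom_set }.

(* Maps between domains are functions on the subtypes of points; derivatives
   are those of any extension to the ambient vector space. *)
Definition smooth_dom n m (U : domain n) (V : domain m) (F : U -> V) : Prop :=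
  exists2 f : 'rV[R]_n -> 'rV[R]_m,
    Cinfty U f & forall u : U, \val (F u) = f (\val u).

(* A parametrization of X with n-dimensional domain. *)
Record param (X : Type) (n : nat) := Param {
  pdom : domain n ;
  param_fun :> pdom -> X }.
#[global] Arguments param_fun {X n} p _.

Definition param_comp X n m (P : param X n) (V : domain m) (F : V -> pdom P) :
  param X m := Param (P \o F).

Definition param_map X Y n (f : X -> Y) (P : param X n) : param Y n :=
  Param (f \o P).

(* A family is a set of parametrizations; the overlap of two domains is the
   set of pairs of points with the same underlying vector. *)
Definition compatible X n (A : set (param X n)) : Prop :=
  forall P P', A P -> A P' -> forall (x : pdom P) (y : pdom P'),
    \val x = \val y -> P x = P' y.

Definition supremum X n (A : set (param X n)) (Q : param X n) : Prop :=
  dom_set (pdom Q) = \bigcup_(P in A) pdom P /\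
  forall P, A P -> forall (x : pdom P) (y : pdom Q),
    \val x = \val y -> P x = Q y.

Record diffeology (X : Type) := Diffeology {
  plots : forall n, set (param X n) ;
  plots_cover : forall x, exists n (P : param X n),
    plots P /\ exists u, P u = x ;
  plots_comp : forall n m (P : param X n) (V : domain m) (F : V -> pdom P),
    plots P -> smooth_dom F -> plots (param_comp F) ;
  plots_sup : forall n (A : set (param X n)) (Q : param X n),
    (forall P, A P -> plots P) -> compatible A -> supremum A Q -> plots Q }.

Record diffspace := DiffSpace {
  carrier :> Type ;
  diffeology_of : diffeology carrier }.

Definition isplot (X : diffspace) n (P : param X n) : Prop :=
  plots (diffeology_of X) P.

Definition dsmooth (X Y : diffspace) (f : X -> Y) : Prop :=
  forall n (P : param X n), isplot P -> isplot (param_map f P).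

Section DomainTheory.
Implicit Types n m p : nat.

Lemma domP n (U : domain n) (x : 'rV[R]_n) : dom_set U x -> exists u : U, \val u = x.
Proof. by move=> Ux; exists (SigSub (mem_set Ux)). Qed.

Definition ext_dom n m (U : domain n) (V : domain m) (F : U -> V)
    (x : 'rV[R]_n) : 'rV[R]_m :=
  if pselect (dom_set U x) is left Ux then \val (F (SigSub (mem_set Ux))) else 0.

Lemma ext_domE n m (U : domain n) (V : domain m) (F : U -> V) (u : U) :
  ext_dom F (\val u) = \val (F u).
Proof.
rewrite /ext_dom; case: pselect => [h|]; last by case; exact: set_valP.
by congr (\val (F _)); exact: val_inj.
Qed.

Lemma smooth_dom_ext n m (U : domain n) (V : domain m) (F : U -> V) :
  smooth_dom F <-> Cinfty U (ext_dom F).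
Proof.
split=> [[f cf fE] k|cF]; last by exists (ext_dom F) => // u; rewrite ext_domE.
apply: Ck_eq (cf k); first exact: dom_open.
by move=> x /domP[u <-]; rewrite ext_domE fE.
Qed.

Lemma smooth_dom_comp n m p (U : domain n) (V : domain m) (W : domain p)
    (F : U -> V) (G : V -> W) :
  smooth_dom F -> smooth_dom G -> smooth_dom (G \o F).
Proof.
move=> [f cf fE] [g cg gE]; exists (g \o f) => [k|u]; last by rewrite /= gE fE.
apply: Ck_comp (cf k) (cg k); [exact: dom_open|exact: dom_open|].
by move=> x /domP[u <-]; rewrite -fE; exact: set_valP.
Qed.

Lemma smooth_dom_cst n m (U : domain n) (V : domain m) (v : V) :
  smooth_dom (fun _ : U => v).
Proof. by exists (fun=> \val v) => // k; exact: Ck_cst. Qed.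

Lemma smooth_dom_val n m (U : domain n) (V : domain m) (W : domain n)
    (F : U -> V) (G : U -> W) :
  (forall u, \val (G u) = \val u) -> smooth_dom G.
Proof. by move=> GE; exists id => // k; exact: Ck_id. Qed.

Lemma smooth_dom_local n m (U : domain n) (V : domain m) (F : U -> V) :
  (forall u : U, exists W : domain n,
     [/\ dom_set W (\val u), dom_set W `<=` U & exists G : W -> V,
       smooth_dom G /\
       forall (w : W) (u' : U), \val w = \val u' -> G w = F u']) ->
  smooth_dom F.
Proof.
move=> H; apply/smooth_dom_ext => k; apply: Ck_local => x /domP[u <-].
have [W [Wu WU [G [/smooth_dom_ext cG GF]]]] := H u.
exists (dom_set W) => //; apply: Ck_eq (cG k); first exact: dom_open.
move=> _ /domP[w <-]; have [u' wu'] := domP (WU _ (set_valP w)).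
by rewrite -{2}wu' !ext_domE; congr (\val _); exact: GF.
Qed.

Lemma smooth_dom_preimage n m (U : domain n) (V : domain m) (F : U -> V)
    (W : domain m) : smooth_dom F ->
  exists U' : domain n, dom_set U' `<=` U /\
    forall u : U, dom_set U' (\val u) <-> dom_set W (\val (F u)).
Proof.
move=> [f cf fE].
have oU' : open (dom_set U `&` f @^-1` dom_set W).
  rewrite openE => x [Ux Wfx]; rewrite /interior; apply: filterI.
    by apply: open_nbhs_nbhs; split => //; exact: dom_open.
  by apply: (cf 0 x Ux); apply: open_nbhs_nbhs; split => //; exact: dom_open.
exists (Domain oU'); split=> [x []//|u /=]; rewrite fE; split=> [[]//|h].
by split => //; exact: set_valP.
Qed.

End DomainTheory.

Definition subparam (X : Type) n (P Q : param X n) : Prop :=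
  dom_set (pdom P) `<=` pdom Q /\
  forall (x : pdom P) (y : pdom Q), \val x = \val y -> P x = Q y.

Lemma supremum_at (X : Type) n (A : set (param X n)) (Q : param X n)
    (u : pdom Q) : supremum A Q ->
  exists P, [/\ A P, dom_set (pdom P) (\val u) & subparam P Q].
Proof.
move=> [dQ H].
have QA x : dom_set (pdom Q) x -> exists2 P, A P & dom_set (pdom P) x.
  by rewrite dQ.
have [P AP Pu] := QA _ (set_valP u); exists P; split=> //.
by split=> [x Px|]; [rewrite dQ; exists P|exact: H].
Qed.

Section PlotTheory.
Variable X : diffspace.

Lemma plot_local n (Q : param X n) :
  (forall u : pdom Q, exists P,
     [/\ isplot P, dom_set (pdom P) (\val u) & subparam P Q]) -> isplot Q.
Proof.
move=> H; apply: (@plots_sup _ _ _ [set P | isplot P /\ subparam P Q]).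
- by move=> P [].
- move=> P P' [_ [sP PQ]] [_ [sP' P'Q]] x y xy.
  have [q qx] := domP (sP _ (set_valP x)).
  by rewrite (PQ x q)// (P'Q y q)// qx.
- split=> [|P [_ []]//]; apply/seteqP; split=> x.
    by move=> /domP[u <-]; have [P [? ? ?]] := H u; exists P.
  by move=> [P [_ [sP _]]]; exact: sP.
Qed.

Lemma plot_cst n (U : domain n) (x : X) : isplot (Param (fun _ : U => x)).
Proof.
have [m [P [pP [u <-]]]] := plots_cover (diffeology_of X) x.
exact: (plots_comp pP (smooth_dom_cst U u)).
Qed.

End PlotTheory.

Lemma subparam_map (X Y : Type) (f : X -> Y) n (P Q : param X n) :
  subparam P Q -> subparam (param_map f P) (param_map f Q).
Proof. by move=> [sP PQ]; split=> // x y xy; congr f; exact: PQ. Qed.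

Lemma dsmooth_cst (X Y : diffspace) (y : Y) : dsmooth (fun _ : X => y).
Proof. by move=> n P _; exact: plot_cst. Qed.

Lemma dsmooth_id (X : diffspace) : dsmooth (@id X).
Proof. by move=> n [U P]. Qed.

Lemma dsmooth_comp (X Y Z : diffspace) (f : X -> Y) (g : Y -> Z) :
  dsmooth f -> dsmooth g -> dsmooth (g \o f).
Proof. by move=> sf sg n P /sf/sg. Qed.

Section DomainSpace.
Variables (n : nat) (U : domain n).

Let dom_plots m : set (param U m) := [set P : param U m | smooth_dom (param_fun P)].

Let dom_cover (u : U) : exists m (P : param U m),
  dom_plots P /\ exists v, P v = u.
Proof.
have oT : open [set: 'rV[R]_0] by exact: openT.
exists 0%N, (Param (fun _ : Domain oT => u)); split.
  exact: smooth_dom_cst.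
by have [v _] := @domP 0 (Domain oT) 0 I; exists v.
Qed.

Let dom_sup m (A : set (param U m)) (Q : param U m) :
  (forall P, A P -> dom_plots P) -> compatible A -> supremum A Q ->
  dom_plots Q.
Proof.
move=> Ap _ sQ; apply: smooth_dom_local => u.
have [P [AP Pu [sP PQ]]] := supremum_at (u : pdom Q) sQ; exists (pdom P); split=> //.
by exists (param_fun P); split; [exact: Ap|exact: PQ].
Qed.

Definition dom_diffeology : diffeology U :=
  Diffeology dom_cover
    (fun m p P V F (pP : dom_plots P) (sF : smooth_dom F) =>
       smooth_dom_comp sF pP)
    dom_sup.

Definition dom_space : diffspace := DiffSpace dom_diffeology.

End DomainSpace.

Section ProdSpace.
Variables X Y : diffspace.

Let prod_plots n : set (param (X * Y) n) :=
  [set P | isplot (param_map fst P) /\ isplot (param_map snd P)].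

Let prod_cover (z : X * Y) : exists n (P : param (X * Y) n),
  prod_plots P /\ exists u, P u = z.
Proof.
have oT : open [set: 'rV[R]_0] by exact: openT.
exists 0%N, (Param (fun _ : Domain oT => z)); split.
  by split; exact: plot_cst.
by have [v _] := @domP 0 (Domain oT) 0 I; exists v.
Qed.

Let prod_comp n m (P : param (X * Y) n) (V : domain m) (F : V -> pdom P) :
  prod_plots P -> smooth_dom F -> prod_plots (param_comp F).
Proof.
move=> [pX pY] sF; split; first exact: (plots_comp pX sF).
exact: (plots_comp pY sF).
Qed.

Let prod_sup n (A : set (param (X * Y) n)) (Q : param (X * Y) n) :
  (forall P, A P -> prod_plots P) -> compatible A -> supremum A Q ->
  prod_plots Q.
Proof.
move=> Ap _ sQ.
split; apply: plot_local => u; have [P [AP Pu PQ]] := supremum_at (u : pdom Q) sQ;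
  have [pX pY] := Ap _ AP.
  by exists (param_map fst P); split=> //; exact: subparam_map.
by exists (param_map snd P); split=> //; exact: subparam_map.
Qed.

Definition prod_space : diffspace :=
  DiffSpace (Diffeology prod_cover prod_comp prod_sup).

End ProdSpace.

Lemma dsmooth_fst (X Y : diffspace) : dsmooth (fst : prod_space X Y -> X).
Proof. by move=> n P []. Qed.

Lemma dsmooth_snd (X Y : diffspace) : dsmooth (snd : prod_space X Y -> Y).
Proof. by move=> n P []. Qed.

Lemma dsmooth_pair (Z X Y : diffspace) (f : Z -> X) (g : Z -> Y) :
  dsmooth f -> dsmooth g -> dsmooth (fun z => (f z, g z) : prod_space X Y).
Proof. by move=> sf sg n P pP; split; [exact: sf|exact: sg]. Qed.

Section SubSpace.
Variables (X : diffspace) (A : set X).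

Let sub_plots n : set (param A n) := [set P | isplot (param_map \val P)].

Let sub_cover (z : A) : exists n (P : param A n),
  sub_plots P /\ exists u, P u = z.
Proof.
have oT : open [set: 'rV[R]_0] by exact: openT.
exists 0%N, (Param (fun _ : Domain oT => z)); split; first exact: plot_cst.
by have [v _] := @domP 0 (Domain oT) 0 I; exists v.
Qed.

Let sub_comp n m (P : param A n) (V : domain m) (F : V -> pdom P) :
  sub_plots P -> smooth_dom F -> sub_plots (param_comp F).
Proof. by move=> pP sF; exact: (plots_comp pP sF). Qed.

Let sub_sup n (B : set (param A n)) (Q : param A n) :
  (forall P, B P -> sub_plots P) -> compatible B -> supremum B Q ->
  sub_plots Q.
Proof.
move=> Bp _ sQ; apply: plot_local => u.
have [P [BP Pu PQ]] := supremum_at (u : pdom Q) sQ.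
by exists (param_map \val P); split; [exact: Bp| |exact: subparam_map].
Qed.

Definition sub_space : diffspace :=
  DiffSpace (Diffeology sub_cover sub_comp sub_sup).

End SubSpace.

Record diffeo (X Y : diffspace) := Diffeo {
  dfun :> X -> Y ;
  dinv : Y -> X ;
  dfun_smooth : dsmooth dfun ;
  dinv_smooth : dsmooth dinv ;
  dfunK : cancel dfun dinv ;
  dinvK : cancel dinv dfun }.

Lemma diffeo_eq (X Y : diffspace) (f g : diffeo X Y) :
  (forall x, f x = g x) -> f = g.
Proof.
case: f g => [f f' sf sf' fK f'K] [g g' sg sg' gK g'K] /= fg.
have {}fg : f = g by exact/funext.
subst g; have f'g' : f' = g' by apply/funext => y; rewrite -{1}(g'K y) fK.
by subst g'; congr Diffeo; exact: Prop_irrelevance.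
Qed.

Section DiffSpaceT.
Variable T : diffspace.

(* The functional diffeology on Diff(T). *)
Let diff_plots n : set (param (diffeo T T) n) := [set P : param (diffeo T T) n |
  dsmooth (fun z : prod_space (dom_space (pdom P)) T => P z.1 z.2) /\
  dsmooth (fun z : prod_space (dom_space (pdom P)) T => dinv (P z.1) z.2)].

Let diff_cover (f : diffeo T T) : exists n (P : param (diffeo T T) n),
  diff_plots P /\ exists u, P u = f.
Proof.
have oT : open [set: 'rV[R]_0] by exact: openT.
exists 0%N, (Param (fun _ : Domain oT => f)); split.
  split=> /=; apply: (dsmooth_comp (@dsmooth_snd _ _)).
    exact: dfun_smooth.
  exact: dinv_smooth.
by have [v _] := @domP 0 (Domain oT) 0 I; exists v.
Qed.

Let diff_comp n m (P : param (diffeo T T) n) (V : domain m) (F : V -> pdom P) :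
  diff_plots P -> smooth_dom F -> diff_plots (param_comp F).
Proof.
move=> [s1 s2] sF.
have sG : dsmooth (fun z : prod_space (dom_space V) T =>
    (F z.1, z.2) : prod_space (dom_space (pdom P)) T).
  apply: dsmooth_pair; last exact: dsmooth_snd.
  apply: (dsmooth_comp (@dsmooth_fst _ _)).
  by move=> p Q pQ; exact: (smooth_dom_comp pQ sF).
by split; [exact: (dsmooth_comp sG s1)|exact: (dsmooth_comp sG s2)].
Qed.

Let sup_smooth n (A : set (param (diffeo T T) n)) (Q : param (diffeo T T) n)
    (ev : diffeo T T -> T -> T) :
  supremum A Q ->
  (forall P, A P ->
     dsmooth (fun z : prod_space (dom_space (pdom P)) T => ev (P z.1) z.2)) ->
  dsmooth (fun z : prod_space (dom_space (pdom Q)) T => ev (Q z.1) z.2).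
Proof.
move=> sQ Ap m S [S1 S2]; apply: plot_local => u.
have [P [AP Pu [_ PQ]]] := supremum_at ((S u).1 : pdom Q) sQ.
have [W [WS WE]] := smooth_dom_preimage (pdom P) S1.
pose incl (w : W) : pdom S := SigSub (mem_set (WS _ (set_valP w))).
have inP (w : W) : dom_set (pdom P) (\val (S (incl w)).1).
  exact: ((WE (incl w)).1 (set_valP w)).
pose S' : param (prod_space (dom_space (pdom P)) T) m :=
  Param (fun w : W => (SigSub (mem_set (inP w)) : pdom P, (S (incl w)).2)).
have sincl : smooth_dom incl by exact: (@smooth_dom_val _ _ _ _ _ id).
have pS' : isplot S'.
  split; last exact: (plots_comp S2 sincl).
  have [f cf fE] := smooth_dom_comp sincl S1.
  by exists f => // w; rewrite -fE.
exists (param_map (fun z : prod_space (dom_space (pdom P)) T => ev (P z.1) z.2) S').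
split; [exact: Ap|exact: ((WE u).2 Pu)|].
split=> [x /WS//|x y xy] /=.
have xy' : incl x = y by exact: val_inj.
by congr (ev _ _); [apply: PQ; rewrite /= -xy'|rewrite xy'].
Qed.

Let diff_sup n (A : set (param (diffeo T T) n)) (Q : param (diffeo T T) n) :
  (forall P, A P -> diff_plots P) -> compatible A -> supremum A Q ->
  diff_plots Q.
Proof.
move=> Ap _ sQ; split.
  by apply: (sup_smooth (ev := fun f t => f t) sQ) => P /Ap[].
by apply: (sup_smooth (ev := fun f t => dinv f t) sQ) => P /Ap[].
Qed.

Definition Diff_space : diffspace :=
  DiffSpace (Diffeology diff_cover diff_comp diff_sup).

End DiffSpaceT.

(* Diffeological groups; the right unit and right inverse laws follow. *)
Record diffgroup := DiffGroup {
  dg_space :> diffspace ;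
  dg_one : dg_space ;
  dg_mul : dg_space -> dg_space -> dg_space ;
  dg_inv : dg_space -> dg_space ;
  dg_mulA : associative dg_mul ;
  dg_mul1g : left_id dg_one dg_mul ;
  dg_mulVg : left_inverse dg_one dg_inv dg_mul ;
  dg_mul_smooth :
    dsmooth (fun z : prod_space dg_space dg_space => dg_mul z.1 z.2) ;
  dg_inv_smooth : dsmooth dg_inv }.

Section DiffGroupT.
Variable T : diffspace.

Definition diffeo_id : diffeo T T :=
  @Diffeo T T id id (@dsmooth_id T) (@dsmooth_id T) (fun=> erefl) (fun=> erefl).

Definition diffeo_comp (f g : diffeo T T) : diffeo T T :=
  Diffeo (dsmooth_comp (dfun_smooth g) (dfun_smooth f))
         (dsmooth_comp (dinv_smooth f) (dinv_smooth g))
         (can_comp (dfunK f) (dfunK g))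
         (can_comp (dinvK g) (dinvK f)).

Definition diffeo_inv (f : diffeo T T) : diffeo T T :=
  Diffeo (dinv_smooth f) (dfun_smooth f) (dinvK f) (dfunK f).

Let mul_smooth : dsmooth
  (fun z : prod_space (Diff_space T) (Diff_space T) => diffeo_comp z.1 z.2 : Diff_space T).
Proof.
move=> n P [[f1 f2] [g1 g2]].
pose Y := prod_space (dom_space (pdom P)) T.
have h1 : dsmooth (fun z : Y => (z.1, (P z.1).2 z.2) : Y).
  by apply: dsmooth_pair; [exact: dsmooth_fst|exact: g1].
have h2 : dsmooth (fun z : Y => (z.1, dinv (P z.1).1 z.2) : Y).
  by apply: dsmooth_pair; [exact: dsmooth_fst|exact: f2].
by split; [exact: (dsmooth_comp h1 f1)|exact: (dsmooth_comp h2 g2)].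
Qed.

Let inv_smooth : dsmooth (diffeo_inv : Diff_space T -> Diff_space T).
Proof. by move=> n P [f1 f2]; split. Qed.

Let diffeo_compA : associative diffeo_comp.
Proof. by move=> f g h; exact: diffeo_eq. Qed.

Let diffeo_1comp : left_id diffeo_id diffeo_comp.
Proof. by move=> f; exact: diffeo_eq. Qed.

Let diffeo_Vcomp : left_inverse diffeo_id diffeo_inv diffeo_comp.
Proof. by move=> f; apply: diffeo_eq => x; exact: dfunK. Qed.

Definition Diff_group : diffgroup :=
  @DiffGroup (Diff_space T) diffeo_id diffeo_comp diffeo_inv
    diffeo_compA diffeo_1comp diffeo_Vcomp mul_smooth inv_smooth.

End DiffGroupT.

(* An action of G on T is a smooth homomorphism from G to Diff(T), whose product
   is composition. *)
Record diffaction (G : diffgroup) (T : diffspace) := DiffAction {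
  act :> G -> Diff_group T ;
  act_smooth : dsmooth act ;
  act_mul : {morph act : g h / dg_mul g h} }.

Definition id_action (T : diffspace) : diffaction (Diff_group T) T :=
  @DiffAction (Diff_group T) T id (@dsmooth_id _) (fun _ _ => erefl).

Definition pullback_space (A B D : diffspace) (f : A -> D) (g : B -> D) :
  diffspace := @sub_space (prod_space A B) [set z | f z.1 = g z.2].

Definition is_pullback (A B C D : diffspace)
    (p : A -> B) (q : A -> C) (f : B -> D) (g : C -> D) : Prop :=
  f \o p = g \o q /\
  forall (Z : diffspace) (a : Z -> B) (b : Z -> C),
    dsmooth a -> dsmooth b -> f \o a = g \o b ->
    exists! u : Z -> A, [/\ dsmooth u, p \o u = a & q \o u = b].

(* The subspace of Y over an open set V of the cover carries the subset
   diffeology. *)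
Definition locally_trivial n (U : domain n) (T Y : diffspace) (p : Y -> U) :
    Prop :=
  exists2 A : set (domain n),
    \bigcup_(V in A) dom_set V = dom_set U &
    forall V, A V ->
      exists Phi : diffeo (sub_space [set y : Y | dom_set V (\val (p y))])
                          (prod_space (dom_space V) T),
        forall y, \val (Phi y).1 = \val (p (\val y)).

(* Surjectivity of pi makes the fiber T nonempty as soon as X is nonempty;
   [is_gauge_bundle] below does not require it. *)
Definition is_fiber_bundle (T E X : diffspace) (pi : E -> X) : Prop :=
  [/\ dsmooth pi, forall x, exists e, pi e = x &
    forall n (P : param X n), isplot P ->
      @locally_trivial n (pdom P) T
        (@pullback_space (dom_space (pdom P)) E X P pi)
        (fun z => (\val z).1)].

Record plot (X : diffspace) := Plot {
  plot_dim : nat ;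
  plot_param :> param X plot_dim ;
  plot_isplot : isplot plot_param }.

Definition pldom (X : diffspace) (P : plot X) : domain (plot_dim P) := pdom P.

Record plot_mor (X : diffspace) (Q P : plot X) := PlotMor {
  mor_fun :> pldom Q -> pldom P ;
  mor_smooth : smooth_dom mor_fun ;
  mor_comm : forall r, P (mor_fun r) = Q r }.

Definition mor_comp (X : diffspace) (P Q S : plot X)
    (f : plot_mor Q P) (g : plot_mor S Q) : plot_mor S P :=
  PlotMor (smooth_dom_comp (mor_smooth g) (mor_smooth f))
    (fun r => etrans (mor_comm f (g r)) (mor_comm g r)).

(* Covering generating families. *)
Record cgf (X : diffspace) := Cgf {
  cgf_set :> set (plot X) ;
  cgf_cover : forall x, exists2 P, cgf_set P & exists u, P u = x ;
  cgf_gen : forall Q : plot X, exists A : set (param X (plot_dim Q)),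
    [/\ compatible A, supremum A Q &
      forall S, A S -> exists2 P, cgf_set P &
        exists2 F : pdom S -> pldom P, smooth_dom F & forall r, S r = P (F r)] }.

(* The diagram P0 <-F1- Q -F0-> P1. *)
Record simplex1 (X : diffspace) (C : cgf X) := Simplex1 {
  s1_P0 : C ;
  s1_P1 : C ;
  s1_Q : plot X ;
  s1_F1 : plot_mor s1_Q (\val s1_P0) ;
  s1_F0 : plot_mor s1_Q (\val s1_P1) }.

(* The fields s2_Fij are the maps F_{i,j} out of Q_i:
     P0 <-F21- Q2 -F20-> P1,  P0 <-F12- Q1 -F10-> P2,  P1 <-F02- Q0 -F01-> P2. *)
Record simplex2 (X : diffspace) (C : cgf X) := Simplex2 {
  s2_P0 : C ;
  s2_P1 : C ;
  s2_P2 : C ;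
  s2_Q2 : plot X ;
  s2_Q1 : plot X ;
  s2_Q0 : plot X ;
  s2_F21 : plot_mor s2_Q2 (\val s2_P0) ;
  s2_F20 : plot_mor s2_Q2 (\val s2_P1) ;
  s2_F12 : plot_mor s2_Q1 (\val s2_P0) ;
  s2_F10 : plot_mor s2_Q1 (\val s2_P2) ;
  s2_F02 : plot_mor s2_Q0 (\val s2_P1) ;
  s2_F01 : plot_mor s2_Q0 (\val s2_P2) ;
  s2_Q : plot X ;
  s2_F0 : plot_mor s2_Q s2_Q0 ;
  s2_F1 : plot_mor s2_Q s2_Q1 ;
  s2_F2 : plot_mor s2_Q s2_Q2 ;
  s2_comm01 : forall r, s2_F01 (s2_F0 r) = s2_F10 (s2_F1 r) ;
  s2_comm02 : forall r, s2_F02 (s2_F0 r) = s2_F20 (s2_F2 r) ;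
  s2_comm12 : forall r, s2_F12 (s2_F1 r) = s2_F21 (s2_F2 r) }.

Definition face2 X C (S : @simplex2 X C) : simplex1 C :=
  Simplex1 (s2_F21 S) (s2_F20 S).
Definition face1 X C (S : @simplex2 X C) : simplex1 C :=
  Simplex1 (s2_F12 S) (s2_F10 S).
Definition face0 X C (S : @simplex2 X C) : simplex1 C :=
  Simplex1 (s2_F02 S) (s2_F01 S).

(* C' refines C. *)
Record refinement (X : diffspace) (C C' : cgf X) := Refinement {
  ref_idx :> C' -> C ;
  ref_mor : forall S : C', plot_mor (\val S) (\val (ref_idx S)) }.

Record gauge_structure (G : diffgroup) (T : diffspace) (rho : diffaction G T)
    (E X : diffspace) (pi : E -> X) := GaugeStructure {
  gs_cgf : cgf X ;
  gs_psi : forall P : gs_cgf, prod_space (dom_space (pldom (\val P))) T -> E ;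
  gs_psi_smooth : forall P, dsmooth (@gs_psi P) ;
  gs_pullback : forall P : gs_cgf,
    @is_pullback (prod_space (dom_space (pldom (\val P))) T)
      (dom_space (pldom (\val P))) E X fst (@gs_psi P) (\val P) pi ;
  gs_trans : forall S : simplex1 gs_cgf, dom_space (pldom (s1_Q S)) -> G ;
  gs_trans_smooth : forall S, dsmooth (@gs_trans S) ;
  gs_transE : forall (S : simplex1 gs_cgf) (r : pldom (s1_Q S)) (t : T),
    @gs_psi (s1_P1 S) (s1_F0 S r, t) =
    @gs_psi (s1_P0 S) (s1_F1 S r, rho (@gs_trans S r) t) }.
#[global] Arguments gs_psi {G T rho E X pi} _ P _.
#[global] Arguments gs_trans {G T rho E X pi} _ S _.
#[global] Arguments gs_psi_smooth {G T rho E X pi} _ P.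
#[global] Arguments gs_trans_smooth {G T rho E X pi} _ S.
#[global] Arguments gs_transE {G T rho E X pi} _ S r t.

Definition is_gauge_bundle (G : diffgroup) (T : diffspace)
    (rho : diffaction G T) (E X : diffspace) (pi : E -> X) : Prop :=
  dsmooth pi /\ inhabited (gauge_structure rho pi).

Record gauge_bundle (G : diffgroup) (T : diffspace) (rho : diffaction G T)
    (X : diffspace) := GaugeBundle {
  gb_total : diffspace ;
  gb_proj : gb_total -> X ;
  gb_smooth : dsmooth gb_proj ;
  gb_struct :> gauge_structure rho gb_proj }.

Definition gauge_iso (G : diffgroup) (T : diffspace) (rho : diffaction G T)
    (X : diffspace) (b b' : gauge_bundle rho X) : Prop :=
  exists Phi : diffeo (gb_total b) (gb_total b'),
    (forall e, gb_proj (Phi e) = gb_proj e) /\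
    exists (D : cgf X) (l : refinement (gs_cgf b) D)
           (l' : refinement (gs_cgf b') D),
    forall S : D, exists h : dom_space (pldom (\val S)) -> G,
      dsmooth h /\
      forall r t, Phi (gs_psi b (l S) (ref_mor l S r, t)) =
                  gs_psi b' (l' S) (ref_mor l' S r, rho (h r) t).

Record fiber_bundle (T X : diffspace) := FiberBundle {
  fb_total : diffspace ;
  fb_proj : fb_total -> X ;
  fb_is_bundle : is_fiber_bundle T fb_proj }.

Definition fiber_iso (T X : diffspace) (b b' : fiber_bundle T X) : Prop :=
  exists Phi : diffeo (fb_total b) (fb_total b'),
    forall e, fb_proj (Phi e) = fb_proj e.

End Diffeology.

(* Sets of equivalence classes.  Classes are predicates [A -> Prop] rather than
   [set A] because [set] is universe monomorphic and also used at the level of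
   the carriers of diffeological spaces, below the type of all bundles. *)
Definition eclasses (A : Type) (e : A -> A -> Prop) : Type :=
  {c : A -> Prop | exists a, c = e a}.

Definition eclass (A : Type) (e : A -> A -> Prop) (a : A) : eclasses e :=
  exist _ (e a) (ex_intro _ a erefl).

Definition erepr (A : Type) (e : A -> A -> Prop) (c : eclasses e) : A :=
  sval (cid (svalP c)).

Section Quot.
Variables (A : Type) (e : A -> A -> Prop).

Lemma eclass_repr (c : eclasses e) : eclass e (erepr c) = c.
Proof.
case: c => c cP; apply: eq_exist; rewrite /erepr /=.
by case: cid => a /= ->.
Qed.

Hypotheses (e_refl : forall x, e x x) (e_sym : forall x y, e x y -> e y x).
Hypothesis e_trans : forall x y z, e x y -> e y z -> e x z.

Lemma eclass_eqP x y : eclass e x = eclass e y <-> e x y.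
Proof.
split=> [/(congr1 sval)/= ->|xy]; first exact: e_refl.
apply: eq_exist; apply/funext => z; apply/propext; split; apply: e_trans => //.
exact: e_sym.
Qed.

End Quot.

Section Cech.
Variables (R : realType) (X : diffspace R) (G : diffgroup R).

Record cocycle (C : cgf X) := Cocycle {
  coc_fun :> forall S : simplex1 C, dom_space (pldom (s1_Q S)) -> G ;
  coc_smooth : forall S, dsmooth (@coc_fun S) ;
  coc_mul : forall (S : simplex2 C) (r : pldom (s2_Q S)),
    dg_mul (@coc_fun (face2 S) (s2_F2 S r)) (@coc_fun (face0 S) (s2_F0 S r)) =
    @coc_fun (face1 S) (s2_F1 S r) }.
#[global] Arguments coc_fun {C} _ S _.
#[global] Arguments coc_smooth {C} _ S.
#[global] Arguments coc_mul {C} _ S r.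

Definition cohomologous (C : cgf X) (g g' : cocycle C) : Prop :=
  exists h : forall P : C, dom_space (pldom (\val P)) -> G,
    (forall P, dsmooth (h P)) /\
    forall (S : simplex1 C) (r : pldom (s1_Q S)),
      dg_mul (g' S r) (h (s1_P1 S) (s1_F0 S r)) =
      dg_mul (h (s1_P0 S) (s1_F1 S r)) (g S r).

Definition H1 (C : cgf X) : Type := eclasses (@cohomologous C).

Lemma dg_mulgV : right_inverse (dg_one G) (@dg_inv R G) (@dg_mul R G).
Proof.
move=> x; rewrite -[LHS]dg_mul1g -[in LHS](dg_mulVg (dg_inv x)) -dg_mulA.
by rewrite [dg_mul (dg_inv x) _]dg_mulA dg_mulVg dg_mul1g dg_mulVg.
Qed.

Lemma dg_mulg1 : right_id (dg_one G) (@dg_mul R G).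
Proof. by move=> x; rewrite -(dg_mulVg x) dg_mulA dg_mulgV dg_mul1g. Qed.

Lemma dsmooth_mul (Z : diffspace R) (f g : Z -> G) :
  dsmooth f -> dsmooth g -> dsmooth (fun z => dg_mul (f z) (g z)).
Proof.
by move=> sf sg; exact: (dsmooth_comp (dsmooth_pair sf sg) (@dg_mul_smooth R G)).
Qed.

Lemma cohomologous_refl (C : cgf X) (g : cocycle C) : cohomologous g g.
Proof.
exists (fun _ _ => dg_one G); split=> [P|S r]; first exact: dsmooth_cst.
by rewrite dg_mulg1 dg_mul1g.
Qed.

Lemma cohomologous_sym (C : cgf X) (g g' : cocycle C) :
  cohomologous g g' -> cohomologous g' g.
Proof.
move=> [h [sh hE]]; exists (fun P r => dg_inv (h P r)); split=> [P|S r].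
  exact: (dsmooth_comp (sh P) (@dg_inv_smooth R G)).
set h1 := h (s1_P1 S) _; set h0 := h (s1_P0 S) _.
have {}hE : dg_mul (g' S r) h1 = dg_mul h0 (g S r) by exact: hE.
have -> : g S r = dg_mul (dg_inv h0) (dg_mul (g' S r) h1).
  by rewrite hE dg_mulA dg_mulVg dg_mul1g.
by rewrite -!dg_mulA dg_mulgV dg_mulg1.
Qed.

Lemma cohomologous_trans (C : cgf X) (g1 g2 g3 : cocycle C) :
  cohomologous g1 g2 -> cohomologous g2 g3 -> cohomologous g1 g3.
Proof.
move=> [h [sh hE]] [k [sk kE]].
exists (fun P r => dg_mul (k P r) (h P r)); split=> [P|S r].
  exact: dsmooth_mul.
by rewrite dg_mulA kE -dg_mulA hE dg_mulA.
Qed.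

Section Refine.
Variables (C C' : cgf X) (l : refinement C C').

Definition refine_simplex1 (S : simplex1 C') : simplex1 C :=
  Simplex1 (mor_comp (ref_mor l (s1_P0 S)) (s1_F1 S))
           (mor_comp (ref_mor l (s1_P1 S)) (s1_F0 S)).

Definition refine_simplex2 (S : simplex2 C') : simplex2 C.
Proof.
refine (@Simplex2 R X C _ _ _ _ _ _
  (mor_comp (ref_mor l (s2_P0 S)) (s2_F21 S))
  (mor_comp (ref_mor l (s2_P1 S)) (s2_F20 S))
  (mor_comp (ref_mor l (s2_P0 S)) (s2_F12 S))
  (mor_comp (ref_mor l (s2_P2 S)) (s2_F10 S))
  (mor_comp (ref_mor l (s2_P1 S)) (s2_F02 S))
  (mor_comp (ref_mor l (s2_P2 S)) (s2_F01 S))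
  _ (s2_F0 S) (s2_F1 S) (s2_F2 S) _ _ _) => r /=; congr (ref_mor _ _ _).
- exact: s2_comm01.
- exact: s2_comm02.
- exact: s2_comm12.
Defined.

Definition refine_cocycle (g : cocycle C) : cocycle C' :=
  @Cocycle C' (fun S => g (refine_simplex1 S))
    (fun S => coc_smooth g (refine_simplex1 S))
    (fun S => coc_mul g (refine_simplex2 S)).

Lemma refine_cohomologous (g g' : cocycle C) :
  cohomologous g g' -> cohomologous (refine_cocycle g) (refine_cocycle g').
Proof.
move=> [h [sh hE]].
exists (fun P r => h (l P) (ref_mor l P r)); split=> [P|S r]; last first.
  exact: (hE (refine_simplex1 S)).
have sm : @dsmooth R (dom_space (pldom (\val P)))
    (dom_space (pldom (\val (l P)))) (ref_mor l P).
  by move=> n p pp; exact: (smooth_dom_comp pp (mor_smooth _)).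
exact: (dsmooth_comp sm (sh (l P))).
Qed.

Definition H1_refine (c : H1 C) : H1 C' :=
  eclass (@cohomologous C') (refine_cocycle (erepr c)).

Lemma H1_refine_eclass (g : cocycle C) :
  H1_refine (eclass (@cohomologous C) g) =
  eclass (@cohomologous C') (refine_cocycle g).
Proof.
have E D (x y : cocycle D) := eclass_eqP (@cohomologous_refl D)
  (@cohomologous_sym D) (@cohomologous_trans D) x y.
apply/E/refine_cohomologous/E; exact: eclass_repr.
Qed.

End Refine.

(* Elements of the H1 X C G represent the same element of the direct limit when
   they agree on a common refinement. *)
Definition cech_eq (x y : {C : cgf X & H1 C}) : Prop :=
  exists (D : cgf X) (l : refinement (tag x) D) (l' : refinement (tag y) D),
    H1_refine l (tagged x) = H1_refine l' (tagged y).

Definition cech_H1 : Type := eclasses cech_eq.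

Definition cech_class (C : cgf X) (g : cocycle C) : cech_H1 :=
  eclass cech_eq (Tagged H1 (eclass (@cohomologous C) g)).

End Cech.

Definition Bund (R : realType) (G : diffgroup R) (T : diffspace R)
    (rho : diffaction G T) (X : diffspace R) : Type :=
  eclasses (@gauge_iso R G T rho X).

Definition Bund_fiber (R : realType) (X T : diffspace R) : Type :=
  eclasses (@fiber_iso R T X).

(* Main.v *)
From mathcomp Require Import all_boot all_order all_algebra.
From mathcomp Require Import all_classical all_reals all_analysis.
Require Import Defs.

Set Implicit Arguments.
Unset Strict Implicit.
Unset Printing Implicit Defensive.

(** Both notions of bundle say that E looks like a product along plots, and the
    common language is that of a chart: a smooth map psi : B * T -> E over
    f : B -> X that makes the square over pi a pullback, which unfolds into
    injectivity on fibers and smooth liftings ([chart_pullback]).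

    Gauge bundles are fiber bundles.  Any plot of X factors locally through a
    member P of the generating family, and the chart over P, pulled back along
    the factorization, trivializes the pullback bundle there.  Conversely, given
    a fiber bundle, the plots whose pullback is globally trivial form a covering
    generating family, since every plot restricts locally to such plots; each
    trivialization is a chart.  The transition maps come for free when the gauge
    group is the whole of Diff(T): two charts over the same base differ by a
    unique smooth family of diffeomorphisms of T ([chart_transition]).

    That same uniqueness forces the transition maps of a gauge bundle to satisfy
    the cocycle identity ([gs_trans_mul]), and makes every diffeomorphism over X
    between gauge bundles a gauge isomorphism ([diffeo_gauge_iso]).  So for
    bundles the three equivalences under study reduce to a single one, the
    existence of a diffeomorphism over X: gauge isomorphism
    ([gauge_iso_over]), equality of the cocycle classes in the limit
    ([cech_eq_over]), and fiber bundle isomorphism.  For the Cech side, an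
    isomorphism read in charts over a common refinement is exactly a family h
    relating the two refined cocycles; conversely such a family prescribes the
    isomorphism chart by chart, and the pieces glue ([glue_diffeo]).  Injectivity
    of all the maps between sets of classes follows, and so does the transitivity
    of the relation defining the direct limit.

    Surjectivity onto Cech cohomology needs a bundle with a prescribed cocycle g.
    Evaluating g on 0-dimensional simplices gives an element g(a, b) of the group
    for any two points a, b of members of the family lying over the same point of
    X, multiplicative in (a, b) and determining g ([coc_atE], [coc_at_mul]).
    After the choice of a base point a(x) over each x, the total space can be
    taken to be the set X * T itself, the chart over P sending (u, t) to
    (P u, g(a(P u), u) t).  The choice of a is arbitrary, in general
    not smooth, so X * T does not get the product diffeology: a family is a plot
    when its projection to X and its coordinates in these charts are.  The charts
    are smooth because a change of chart does not involve a. *)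

Import numFieldNormedType.Exports.

Local Open Scope classical_set_scope.
Local Open Scope ring_scope.

(** * Plots and smooth maps *)

Section Smooth.
Context {R : realType}.
Implicit Types X Y Z T : diffspace R.

Lemma smooth_dom_id n (U : domain R n) : smooth_dom (fun u : U => u).
Proof. exact: (@smooth_dom_val _ _ _ _ _ _ (fun u : U => u)). Qed.

Lemma dsmooth_dom n m (U : domain R n) (V : domain R m) (F : U -> V) :
  smooth_dom F -> @dsmooth R (dom_space U) (dom_space V) F.
Proof. by move=> sF p P pP; exact: (smooth_dom_comp pP sF). Qed.

(** With [plot_dsmooth] below, plots are the smooth maps out of domains; the
    proofs about plots can then be carried out with composites of smooth maps. *)
Lemma dsmooth_plot X n (P : param R X n) :
  isplot P -> @dsmooth R (dom_space (pdom P)) X P.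
Proof. by move=> pP m Q pQ; exact: (plots_comp pP pQ). Qed.

Lemma plot_dsmooth X n (U : domain R n) (f : U -> X) :
  @dsmooth R (dom_space U) X f -> isplot (Param f).
Proof.
move=> sf; apply: (sf n (Param (fun u : U => u))).
exact: smooth_dom_id.
Qed.

Lemma dsmooth_sub X Z (A : set X) (f : Z -> sub_space A) :
  @dsmooth R Z X (fun z => \val (f z)) -> dsmooth f.
Proof. by move=> sf n P /sf. Qed.

Lemma dsmooth_val X (A : set X) : @dsmooth R (sub_space A) X \val.
Proof. by move=> n P. Qed.

(** Smoothness into a domain is seen in the ambient vector space, so that the
    codomain can be shrunk. *)
Lemma dsmooth_corestrict Z n (U V : domain R n) (f : Z -> U) (g : Z -> V) :
  (forall z, \val (g z) = \val (f z)) ->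
  @dsmooth R Z (dom_space U) f -> @dsmooth R Z (dom_space V) g.
Proof.
move=> gf sf m P /sf[h ch hE]; exists h => // w.
by rewrite /= gf; exact: hE.
Qed.

Lemma dsmooth_Diff Z T (f : Z -> diffeo T T) :
  @dsmooth R (prod_space Z T) T (fun z => f z.1 z.2) ->
  @dsmooth R (prod_space Z T) T (fun z => dinv (f z.1) z.2) ->
  @dsmooth R Z (Diff_space T) f.
Proof.
move=> s1 s2 n P pP.
have sP : @dsmooth R (prod_space (dom_space (pdom P)) T) (prod_space Z T)
    (fun z => (P z.1, z.2)).
  apply: dsmooth_pair; last exact: dsmooth_snd.
  exact: (dsmooth_comp (@dsmooth_fst _ _ _) (dsmooth_plot pP)).
by split; [exact: (dsmooth_comp sP s1)|exact: (dsmooth_comp sP s2)].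
Qed.

Lemma dsmooth_act Z T (g : Z -> diffeo T T) (k : Z -> T) :
  @dsmooth R Z (Diff_space T) g -> dsmooth k -> dsmooth (fun z => g z (k z)).
Proof.
move=> sg sk n P pP; have [s1 _] := sg _ _ pP.
have sp : dsmooth (fun u : dom_space (pdom P) =>
    (u, k (P u)) : prod_space (dom_space (pdom P)) T).
  by apply: dsmooth_pair; [exact: dsmooth_id|exact: (dsmooth_plot (sk _ _ pP))].
exact: (plot_dsmooth (dsmooth_comp sp s1)).
Qed.

Lemma dsmooth_actV Z T (g : Z -> diffeo T T) (k : Z -> T) :
  @dsmooth R Z (Diff_space T) g -> dsmooth k -> dsmooth (fun z => dinv (g z) (k z)).
Proof.
move=> sg; apply: (@dsmooth_act _ _ (fun z => dg_inv (g z : Diff_group T))).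
exact: (dsmooth_comp sg (@dg_inv_smooth _ (Diff_group T))).
Qed.

Definition incl n (U V : domain R n) (VU : dom_set V `<=` U) (v : V) : U :=
  SigSub (mem_set (VU _ (set_valP v))).

Lemma smooth_incl n (U V : domain R n) (VU : dom_set V `<=` U) :
  smooth_dom (incl VU).
Proof. exact: smooth_dom_id. Qed.

(** The sheaf condition, in the form used below: being a plot is checked on
    a neighborhood of each point. *)
Lemma plot_near X n (Q : param R X n) :
  (forall u : pdom Q, exists (V : domain R n) (VQ : dom_set V `<=` pdom Q),
     dom_set V (\val u) /\ isplot (Param (fun v : V => Q (incl VQ v)))) ->
  isplot Q.
Proof.
move=> H; apply: plot_local => u; have [V [VQ [Vu pV]]] := H u.
exists (Param (fun v : V => Q (incl VQ v))); split=> //; split=> //= x y xy.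
by congr (Q _); exact: val_inj.
Qed.

(** Plots with this one-point domain are the points of a diffeological space. *)
Definition pt_dom : domain R 0 := Domain (@openT 'rV[R]_0).

Definition pt0 : pt_dom := SigSub (mem_set (I : [set: 'rV[R]_0] 0%R)).

End Smooth.

(** * Charts: squares that are pullbacks *)

Section Chart.
Context {R : realType}.
Implicit Types B X Z T E : diffspace R.

(** The elementwise form of a pullback square: the last two clauses are the
    uniqueness and the existence of liftings. *)
Definition chart B T E X (f : B -> X) (pi : E -> X)
    (psi : prod_space B T -> E) : Prop :=
  [/\ dsmooth psi, forall b t, pi (psi (b, t)) = f b,
      forall b t t', psi (b, t) = psi (b, t') -> t = t' &
      forall Z (a : Z -> B) (e : Z -> E), dsmooth a -> dsmooth e ->
        (forall z, f (a z) = pi (e z)) ->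
        exists2 k : Z -> T, dsmooth k & forall z, psi (a z, k z) = e z].

(** A lifting is determined by its values.  Conversely, two points of a fiber
    with the same image give two constant liftings of the same data, so
    uniqueness of liftings yields injectivity. *)
Lemma chart_pullback B T E X (f : B -> X) (pi : E -> X)
    (psi : prod_space B T -> E) :
  chart f pi psi <->
  dsmooth psi /\ @is_pullback R (prod_space B T) B E X fst psi f pi.
Proof.
split=> [[s c inj lift]|[s [c univ]]]; split=> //.
- split=> [|Z a e sa se fae]; first by apply/funext => -[b t] /=; rewrite c.
  have [z|k sk kE] := lift _ _ _ sa se; first exact: (congr1 (@^~ z) fae).
  exists (fun z => (a z, k z)); split.
    by split=> //; [exact: dsmooth_pair|exact/funext].
  move=> u [su u1 u2]; apply/funext => z.
  have := congr1 (@^~ z) u1; have := congr1 (@^~ z) u2 => /=.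
  by case: (u z) => b t /= + bE; rewrite bE -kE => /inj ->.
- by move=> b t; have /= -> := congr1 (@^~ (b, t)) c.
- move=> b t t' tt'.
  have [|||u [_ uu]] := univ B (fun=> b) (fun=> psi (b, t)).
  + exact: dsmooth_cst.
  + exact: dsmooth_cst.
  + by apply/funext => _ /=; have /= <- := congr1 (@^~ (b, t)) c.
  + have u1 : u = fun=> (b, t).
      by apply: uu; split=> //; exact: dsmooth_cst.
    have u2 : u = fun=> (b, t').
      by apply: uu; split=> //; [exact: dsmooth_cst|apply/funext].
    by have := congr1 (@^~ b) u1; rewrite u2 => -[].
- move=> Z a e sa se fae.
  have [|u [[su u1 u2] _]] := univ Z a e sa se; first exact/funext.
  exists (fun z => (u z).2); first exact: (dsmooth_comp su (@dsmooth_snd _ _ _)).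
  move=> z; have /= <- := congr1 (@^~ z) u1.
  by have /= <- := congr1 (@^~ z) u2; case: (u z).
Qed.

Lemma chart_pull B B' T E X (f : B -> X) (pi : E -> X)
    (psi : prod_space B T -> E) (F : B' -> B) : dsmooth F -> chart f pi psi ->
  @chart B' T E X (f \o F) pi (fun z => psi (F z.1, z.2)).
Proof.
move=> sF [s c inj lift]; split=> [|b t|b t t'|Z a e sa se fae].
- apply: (@dsmooth_comp R (prod_space B' T) (prod_space B T) E
    (fun z => (F z.1, z.2)) psi) => //.
  apply: dsmooth_pair; last exact: dsmooth_snd.
  exact: (dsmooth_comp (@dsmooth_fst _ _ _) sF).
- exact: c.
- exact: inj.
- exact: (lift _ _ _ (dsmooth_comp sa sF) se fae).
Qed.

Lemma chart_twist B T E X (f : B -> X) (pi : E -> X)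
    (psi : prod_space B T -> E) (h : B -> diffeo T T) :
  @dsmooth R B (Diff_space T) h -> chart f pi psi ->
  @chart B T E X f pi (fun z => psi (z.1, h z.1 z.2)).
Proof.
move=> sh [s c inj lift]; split=> [|b t|b t t'|Z a e sa se fae] /=.
- apply: (@dsmooth_comp R (prod_space B T) (prod_space B T) E
    (fun z => (z.1, h z.1 z.2)) psi) => //.
  apply: dsmooth_pair; first exact: dsmooth_fst.
  apply: dsmooth_act; last exact: dsmooth_snd.
  exact: (dsmooth_comp (@dsmooth_fst _ _ _) sh).
- exact: c.
- by move=> /inj /(can_inj (dfunK (h b))).
- have [k sk kE] := lift _ _ _ sa se fae.
  exists (fun z => dinv (h (a z)) (k z)) => [|z]; last by rewrite dinvK.
  exact: (dsmooth_actV (dsmooth_comp sa sh) sk).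
Qed.

Lemma chart_diffeo B T E E' X (f : B -> X) (pi : E -> X) (pi' : E' -> X)
    (psi : prod_space B T -> E) (Phi : diffeo E E') :
  (forall e, pi' (Phi e) = pi e) ->
  chart f pi psi -> chart f pi' (Phi \o psi).
Proof.
move=> PhiE [s c inj lift]; split=> [|b t|b t t'|Z a e sa se fae] /=.
- exact: (dsmooth_comp s (dfun_smooth Phi)).
- by rewrite PhiE c.
- by move=> /(can_inj (dfunK Phi)) /inj.
- have [z|k sk kE] := lift _ _ _ sa (dsmooth_comp se (dinv_smooth Phi)).
    by rewrite fae /= -PhiE dinvK.
  by exists k => // z; rewrite kE /= dinvK.
Qed.

(** Each chart is lifted through the other.  Injectivity on fibers makes the two
    liftings inverse to each other at each point of the base, so they are a
    family of diffeomorphisms, smooth together with its inverse. *)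
Lemma chart_transition B T E X (f : B -> X) (pi : E -> X)
    (psi psi' : prod_space B T -> E) : chart f pi psi -> chart f pi psi' ->
  exists2 g : B -> diffeo T T, @dsmooth R B (Diff_space T) g &
    forall b t, psi' (b, t) = psi (b, g b t).
Proof.
move=> [s c inj lift] [s' c' inj' lift'].
have [|k sk kE] := lift _ _ _ (@dsmooth_fst _ B T) s'.
  by case=> b t; rewrite c'.
have [|k' sk' kE'] := lift' _ _ _ (@dsmooth_fst _ B T) s.
  by case=> b t; rewrite c.
have K b : cancel (fun t => k (b, t)) (fun t => k' (b, t)).
  by move=> t; apply: (inj' b); rewrite (kE' (b, k (b, t))) (kE (b, t)).
have K' b : cancel (fun t => k' (b, t)) (fun t => k (b, t)).
  by move=> t; apply: (inj b); rewrite (kE (b, k' (b, t))) (kE' (b, t)).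
have sb b : dsmooth (fun t : T => (b, t) : prod_space B T).
  by apply: dsmooth_pair; [exact: dsmooth_cst|exact: dsmooth_id].
exists (fun b => Diffeo (dsmooth_comp (sb b) sk) (dsmooth_comp (sb b) sk')
  (K b) (K' b)) => [|b t]; last by rewrite /= (kE (b, t)).
apply: dsmooth_Diff => /=.
  by rewrite (_ : (fun z => _) = k)//; apply/funext => -[].
by rewrite (_ : (fun z => _) = k')//; apply/funext => -[].
Qed.

(** Diff(T) acts effectively on T; hence identities between gauge
    transformations can be checked after applying a chart. *)
Lemma chart_act_inj B T E X (f : B -> X) (pi : E -> X)
    (psi : prod_space B T -> E) b (g g' : diffeo T T) : chart f pi psi ->
  (forall t, psi (b, g t) = psi (b, g' t)) -> g = g'.
Proof. by move=> [_ _ inj _] H; apply: diffeo_eq => t; exact: (inj b). Qed.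

End Chart.
(** * Covering generating families *)

Section Cgf.
Context {R : realType} {X : diffspace R}.

(** A covering generating family is characterized by this local property of all
    plots; unlike the suprema of compatible families, it composes well. *)
Definition factors_near (C : set (plot X)) n (Q : param R X n) (u : pdom Q) :
    Prop :=
  exists (V : domain R n) (VQ : dom_set V `<=` pdom Q),
    dom_set V (\val u) /\
    exists2 P : plot X, C P & exists2 F : V -> pldom P,
      smooth_dom F & forall v, Q (incl VQ v) = P (F v).

Lemma cgf_near (C : cgf X) n (Q : param R X n) (u : pdom Q) :
  isplot Q -> factors_near C u.
Proof.
move=> pQ; have [A [_ sA AC]] := cgf_gen C (Plot pQ).
have [S [AS Su [SQ SE]]] := supremum_at (u : pdom (Plot pQ)) sA.
exists (pdom S), SQ; split=> //; have [P CP [F sF FE]] := AC _ AS.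
by exists P => //; exists F => // v; rewrite -FE; apply/esym/SE.
Qed.

(** The compatible family is that of all restrictions of the plot that factor
    through a member of C; points are covered by factoring constant plots. *)
Section OfNear.
Variable C : set (plot X).
Hypothesis C_near : forall n (Q : param R X n) (u : pdom Q),
  isplot Q -> factors_near C u.

Let cover x : exists2 P : plot X, C P & exists u, P u = x.
Proof.
have [V [VQ [/domP[v _] [P CP [F _ FE]]]]] :=
  C_near (pt0 : pdom (Param (fun _ : pt_dom => x))) (plot_cst _ _).
by exists P => //; exists (F v); rewrite -FE.
Qed.

Let gen (Q : plot X) : exists A : set (param R X (plot_dim Q)),
  [/\ compatible A, supremum A Q &
    forall S, A S -> exists2 P : plot X, C P &
      exists2 F : pdom S -> pldom P, smooth_dom F & forall r, S r = P (F r)].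
Proof.
exists [set S | subparam S Q /\ exists2 P : plot X, C P &
  exists2 F : pdom S -> pldom P, smooth_dom F & forall r, S r = P (F r)].
split=> [S S' [[sS SQ] _] [[sS' S'Q] _] x y xy||S []//].
  have [q qx] := domP (sS _ (set_valP x)).
  by rewrite (SQ x q)// (S'Q y q)// qx.
split=> [|S [[]//]]; apply/seteqP; split=> x; last first.
  by move=> [S [[sS _] _]]; exact: sS.
move=> /domP[u <-]; have [V [VQ [Vu PF]]] := C_near u (plot_isplot Q).
exists (Param (fun v : V => Q (incl VQ v))) => //; split=> //.
by split=> // y z yz; congr (Q _); exact: val_inj.
Qed.

Definition cgf_of_near : cgf X := Cgf cover gen.

End OfNear.

Lemma mor_dsmooth (P Q : plot X) (F : plot_mor Q P) :
  @dsmooth R (dom_space (pldom Q)) (dom_space (pldom P)) F.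
Proof. exact: dsmooth_dom (mor_smooth F). Qed.

(** The plots that map both to a member of C and to a member of C' generate:
    a local factorization through C is factored again, locally, through C'. *)
Lemma common_refinement (C C' : cgf X) :
  exists D : cgf X, inhabited (refinement C D * refinement C' D).
Proof.
pose below (E : cgf X) (S : plot X) := exists P : E, inhabited (plot_mor S (\val P)).
have H n (Q : param R X n) (u : pdom Q) : isplot Q ->
    factors_near [set S | below C S /\ below C' S] u.
  move=> pQ; have [V [VQ [Vu [P CP [F sF FE]]]]] := cgf_near C u pQ.
  have [v vu] := domP Vu.
  have pV := plots_comp pQ (smooth_incl VQ).
  have [V' [V'V [V'v [P' CP' [F' sF' F'E]]]]] :=
    cgf_near C' (v : pdom (Param (fun v : V => Q (incl VQ v)))) pV.
  have pV' := plots_comp pV (smooth_incl V'V).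
  exists V', (fun x V'x => VQ _ (V'V x V'x)); split; first by rewrite -vu.
  exists (Plot pV').
    split; [exists (SigSub (mem_set CP))|exists (SigSub (mem_set CP'))].
      have FF (w : V') : P (F (incl V'V w)) = Plot pV' w by rewrite -FE.
      pose m : plot_mor (Plot pV') P := @PlotMor _ _ (Plot pV') P
        (F \o incl V'V) (smooth_dom_comp (smooth_incl V'V) sF) FF.
      exact: (inhabits m).
    exact: (inhabits (@PlotMor _ _ (Plot pV') P' F' sF' (fun w => esym (F'E w)))).
  exists id; first exact: smooth_dom_id.
  by move=> w; congr (Q _); exact: val_inj.
exists (cgf_of_near H).
have r (E : cgf X) : (forall S : cgf_of_near H, below E (\val S)) ->
    inhabited (refinement E (cgf_of_near H)).
  move=> bE; apply: inhabits; exists (fun S => sval (cid (bE S))) => S.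
  by case: (cid (bE S)) => P /= /inhabited_witness.
have [l] : inhabited (refinement C (cgf_of_near H)).
  by apply: r => S; have /set_mem[] := valP S.
have [l'] : inhabited (refinement C' (cgf_of_near H)).
  by apply: r => S; have /set_mem[] := valP S.
by [].
Qed.

End Cgf.
(** * Gauge bundles and locally trivial pullbacks *)

Section GaugeFiber.
Context {R : realType} {X T : diffspace R}.

Lemma gs_chart (G : diffgroup R) (rho : diffaction G T) (E : diffspace R)
    (pi : E -> X) (s : gauge_structure rho pi) (P : gs_cgf s) :
  @chart R (dom_space (pldom (\val P))) T E X (\val P) pi (gs_psi s P).
Proof.
by apply/chart_pullback; split; [exact: gs_psi_smooth|exact: gs_pullback].
Qed.

(** Over an open set V on which the plot Q equals P \o F with P in the generating
    family, the chart over P pulled back along F trivializes the pullback of the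
    bundle.  A point of T is what makes the projection surjective. *)
Lemma gauge_fiber (G : diffgroup R) (rho : diffaction G T) (E : diffspace R)
    (pi : E -> X) : (inhabited X -> inhabited T) ->
  is_gauge_bundle rho pi -> is_fiber_bundle T pi.
Proof.
move=> XT [spi [s]]; split=> // [x|n Q pQ].
  have [t] := XT (inhabits x); have [P CP [u <-]] := cgf_cover (gs_cgf s) x.
  pose P' : gs_cgf s := SigSub (mem_set CP).
  have [_ c _ _] := gs_chart P'.
  by exists (gs_psi s P' (u, t)); exact: c.
exists [set V | exists (VQ : dom_set V `<=` pdom Q) (P : gs_cgf s)
    (F : V -> pldom (\val P)), smooth_dom F /\
    forall v, Q (incl VQ v) = (\val P) (F v)].
  apply/seteqP; split=> x; first by move=> [V [VQ _] /VQ].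
  move=> /domP[u <-]; have [V [VQ [Vu [P CP [F sF FE]]]]] :=
    cgf_near (gs_cgf s) u pQ.
  by exists V => //; exists VQ, (SigSub (mem_set CP)), F.
move=> V [VQ [P [F [sF FE]]]].
have [s' c inj lift] := chart_pull (dsmooth_dom sF) (gs_chart P).
set Y := sub_space _.
pose toV (y : Y) : V := SigSub (mem_set (set_valP y : dom_set V _)).
have stoV : @dsmooth R Y (dom_space V) toV.
  apply: (@dsmooth_corestrict R Y n (pdom Q) V
    (fun y => (\val (\val y)).1)) => //.
  apply: dsmooth_comp (@dsmooth_fst _ _ _).
  exact: (dsmooth_comp (@dsmooth_val _ _ _) (@dsmooth_val _ _ _)).
have sE : @dsmooth R Y E (fun y => (\val (\val y)).2).
  exact: (dsmooth_comp (dsmooth_comp (@dsmooth_val _ _ _) (@dsmooth_val _ _ _))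
    (@dsmooth_snd _ _ _)).
have [y|k sk kE] := lift _ _ _ stoV sE.
  rewrite -(set_valP (\val y)) /= -FE; congr (Q _).
  exact: val_inj.
pose e (z : prod_space (dom_space V) T) : E := gs_psi s P (F z.1, z.2).
have eP z : [set z : pdom Q * E | Q z.1 = pi z.2] (incl VQ z.1, e z).
  by rewrite /= FE; exact/esym/c.
pose inv0 (z : prod_space (dom_space V) T) :
  @pullback_space R (dom_space (pdom Q)) E X Q pi := SigSub (mem_set (eP z)).
have invP z : [set y : @pullback_space R (dom_space (pdom Q)) E X Q pi |
    dom_set V (\val (\val y).1)] (inv0 z) by exact: set_valP z.1.
pose inv (z : prod_space (dom_space V) T) : Y := SigSub (mem_set (invP z)).
have sinv : dsmooth inv.
  do 2 apply: dsmooth_sub; apply: dsmooth_pair => //.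
  by apply: dsmooth_comp (@dsmooth_fst _ _ _) _; exact/dsmooth_dom/smooth_incl.
have K : cancel (fun y => (toV y, k y) : prod_space (dom_space V) T) inv.
  move=> y; do 2 apply: val_inj.
  rewrite /= /e /= kE [RHS]surjective_pairing; congr pair; exact: val_inj.
have K' : cancel inv (fun y => (toV y, k y)).
  move=> z; have vE : toV (inv z) = z.1 by exact: val_inj.
  rewrite vE; case: z vE => v t vE; congr pair.
  by apply: (inj v); have := kE (inv (v, t)); rewrite vE.
by exists (Diffeo (dsmooth_pair stoV sk) sinv K K').
Qed.

(** The inverse of a trivialization over V, followed by the projection of the
    pullback to E. *)
Lemma local_trivialization_chart (E : diffspace R) (pi : E -> X) n
    (Q : param R X n) (V : domain R n) (VQ : dom_set V `<=` pdom Q)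
    (Phi : diffeo
       (sub_space [set y : @pullback_space R (dom_space (pdom Q)) E X Q pi |
          dom_set V (\val (\val y).1)]) (prod_space (dom_space V) T)) :
  (forall y, \val (Phi y).1 = \val (\val (\val y)).1) ->
  @chart R (dom_space V) T E X (fun v => Q (incl VQ v)) pi
    (fun z => (\val (\val (dinv Phi z))).2).
Proof.
move=> PhiE.
have invE v t : (\val (\val (dinv Phi (v, t)))).1 = incl VQ v.
  by apply: val_inj; rewrite /= -PhiE dinvK.
split=> [|v t|v t t' tt'|Z a e sa se Qa].
- exact: (dsmooth_comp (dinv_smooth Phi) (dsmooth_comp
    (dsmooth_comp (@dsmooth_val _ _ _) (@dsmooth_val _ _ _)) (@dsmooth_snd _ _ _))).
- by rewrite -(invE v t); exact/esym/(set_valP (\val (dinv Phi (v, t)))).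
- suff /(congr1 Phi) : dinv Phi (v, t) = dinv Phi (v, t').
    by rewrite !dinvK => -[].
  do 2 apply: val_inj; have := invE v t; rewrite -(invE v t').
  by move: tt' => /=; case: (\val _) => ? ? /=; case: (\val _) => ? ? /= -> ->.
- have y0P z : [set z : pdom Q * E | Q z.1 = pi z.2] (incl VQ (a z), e z).
    by rewrite /= Qa.
  pose y0 z : @pullback_space R (dom_space (pdom Q)) E X Q pi :=
    SigSub (mem_set (y0P z)).
  have yP z : [set y : @pullback_space R (dom_space (pdom Q)) E X Q pi |
      dom_set V (\val (\val y).1)] (y0 z) by exact: set_valP (a z).
  pose y z : sub_space [set y : @pullback_space R (dom_space (pdom Q)) E X Q pi |
    dom_set V (\val (\val y).1)] := SigSub (mem_set (yP z)).
  have sy : dsmooth y.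
    do 2 apply: dsmooth_sub; apply: dsmooth_pair => //.
  exists (fun z => (Phi (y z)).2).
    exact: (dsmooth_comp (dsmooth_comp sy (dfun_smooth Phi)) (@dsmooth_snd _ _ _)).
  move=> z; rewrite (_ : (a z, _) = Phi (y z)) ?dfunK//.
  have := PhiE (y z); case: (Phi (y z)) => v t /= vE.
  by congr pair; apply: val_inj; exact: esym vE.
Qed.

Definition charted_plot (E : diffspace R) (pi : E -> X) : set (plot X) :=
  [set P : plot X | exists psi : prod_space (dom_space (pldom P)) T -> E,
    @chart R (dom_space (pldom P)) T E X P pi psi].

Lemma charted_near (E : diffspace R) (pi : E -> X) n (Q : param R X n)
    (u : pdom Q) : is_fiber_bundle T pi -> isplot Q ->
  factors_near (charted_plot pi) u.
Proof.
move=> [spi surj triv] pQ; have [A UA Atriv] := triv _ _ pQ.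
have AQ V : A V -> dom_set V `<=` pdom Q.
  by move=> AV x Vx; rewrite -UA; exists V.
have [V AV Vu] : (\bigcup_(V in A) dom_set V) (\val u).
  by rewrite UA; exact: set_valP.
have [Phi PhiE] := Atriv V AV.
have ch := local_trivialization_chart (AQ V AV) PhiE.
have pV := plots_comp pQ (smooth_incl (AQ V AV)).
exists V, (AQ V AV); split=> //; exists (Plot pV); first by eexists; exact: ch.
by exists id => //; exact: smooth_dom_id.
Qed.

(** The generating family consists of the plots over which the bundle has a
    chart; transition maps exist because two charts pulled back to the domain of
    a 1-simplex lie over the same plot. *)
Lemma fiber_gauge (E : diffspace R) (pi : E -> X) :
  is_fiber_bundle T pi -> is_gauge_bundle (id_action T) pi.
Proof.
move=> bpi; have [spi _ _] := bpi; split=> //.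
pose C := cgf_of_near (fun n Q u => @charted_near E pi n Q u bpi).
pose psi (P : C) := sval (cid (set_mem (valP P))).
have ch (P : C) : @chart R (dom_space (pldom (\val P))) T E X (\val P) pi (psi P).
  exact: (svalP (cid (set_mem (valP P)))).
have tr (S : simplex1 C) : exists g : dom_space (pldom (s1_Q S)) -> diffeo T T,
    @dsmooth R _ (Diff_space T) g /\
    forall r t, psi (s1_P1 S) (s1_F0 S r, t) = psi (s1_P0 S) (s1_F1 S r, g r t).
  have := chart_pull (mor_dsmooth (s1_F1 S)) (ch (s1_P0 S)).
  have := chart_pull (mor_dsmooth (s1_F0 S)) (ch (s1_P1 S)).
  have fE (P : C) (F : plot_mor (s1_Q S) (\val P)) : (\val P) \o F = s1_Q S.
    by apply/funext => r; exact: mor_comm.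
  by rewrite !fE => c1 c0; have [g sg gE] := chart_transition c0 c1; exists g.
have psiP P := (chart_pullback _ _ _).1 (ch P).
exact: inhabits (@GaugeStructure _ _ _ (id_action T) _ _ pi C psi
  (fun P => proj1 (psiP P)) (fun P => proj2 (psiP P))
  (fun S => sval (cid (tr S))) (fun S => proj1 (svalP (cid (tr S))))
  (fun S => proj2 (svalP (cid (tr S))))).
Qed.

End GaugeFiber.
(** * The bundle of a cocycle *)

Section CocycleValues.
Context {R : realType} {X : diffspace R} {G : diffgroup R}.
Variables (C : cgf X) (g : cocycle G C).

Definition mor_id (Q : plot X) : plot_mor Q Q :=
  @PlotMor R X Q Q id
    (@smooth_dom_id R _ (pldom Q)) (fun=> erefl).

Definition pt_plot (x : X) : plot X := Plot (plot_cst pt_dom x).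

Definition pt_mor (x : X) (Q : plot X) (r : pldom Q) (rx : Q r = x) :
    plot_mor (pt_plot x) Q :=
  @PlotMor R X (pt_plot x) Q (fun=> r) (smooth_dom_cst _ r) (fun=> rx).

(** The cocycle identity on the 2-simplex all of whose faces are this 1-simplex
    says that the value is idempotent. *)
Lemma coc_id (P : C) (Q : plot X) (F : plot_mor Q (\val P)) (r : pldom Q) :
  g (Simplex1 F F) r = dg_one G.
Proof.
have := coc_mul g (@Simplex2 R X C P P P Q Q Q F F F F F F Q
  (mor_id Q) (mor_id Q) (mor_id Q) (fun=> erefl) (fun=> erefl) (fun=> erefl)) r.
rewrite /face0 /face1 /face2 /=; set x := g _ _ => xx.
by rewrite -[x]dg_mul1g -(dg_mulVg x) -dg_mulA [dg_mul x x]xx.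
Qed.

(** A cocycle sees only the end points of a 1-simplex at a parameter.  This is the
    cocycle identity on the 2-simplex P0, P0, P1 based at one point, with the two
    given simplices as two of its faces; the third face has value 1 by
    [coc_id]. *)
Lemma coc_ends (P0 P1 : C) (Q Q' : plot X)
    (F1 : plot_mor Q (\val P0)) (F0 : plot_mor Q (\val P1))
    (F1' : plot_mor Q' (\val P0)) (F0' : plot_mor Q' (\val P1))
    (r : pldom Q) (r' : pldom Q') : F1 r = F1' r' -> F0 r = F0' r' ->
  g (Simplex1 F1 F0) r = g (Simplex1 F1' F0') r'.
Proof.
move=> E1 E0.
have r'x : Q' r' = Q r by rewrite -(mor_comm F1') -E1 mor_comm.
pose m := pt_mor (erefl (Q r)); pose m' := pt_mor r'x.
have := coc_mul g (@Simplex2 R X C P0 P0 P1 (pt_plot (Q r)) Q' Q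
  (mor_comp F1 m) (mor_comp F1 m) F1' F0' F1 F0 (pt_plot (Q r)) m m' (mor_id _)
  (fun=> E0) (fun=> erefl) (fun=> esym E1)) pt0.
rewrite /face0 /face1 /face2 /= => <-.
by rewrite -[LHS]dg_mul1g; congr dg_mul; exact/esym/coc_id.
Qed.

Record pointed_plot := PointedPlot {
  pp_plot : C ;
  pp_pt : pldom (\val pp_plot) }.

Definition pp_val (a : pointed_plot) : X := (\val (pp_plot a)) (pp_pt a).

(** The value on the 1-simplex from a to b with one-point domain, made total by
    a default value so that no proof that a and b lie over the same point of
    X has to be carried around. *)
Definition coc_at (a b : pointed_plot) : G :=
  if pselect (pp_val b = pp_val a) is left ba then
    g (Simplex1 (pt_mor (erefl (pp_val a))) (pt_mor ba)) pt0
  else dg_one G.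

Lemma coc_atE (S : simplex1 C) (r : pldom (s1_Q S)) :
  g S r = coc_at (PointedPlot (s1_F1 S r)) (PointedPlot (s1_F0 S r)).
Proof.
rewrite /coc_at; case: pselect => [ba|]; last first.
  by case; rewrite /pp_val /= !mor_comm.
by case: S r ba => P0 P1 Q F1 F0 r ba; exact: coc_ends.
Qed.

Lemma coc_at_mul (a b c : pointed_plot) :
  pp_val b = pp_val a -> pp_val c = pp_val a ->
  dg_mul (coc_at a b) (coc_at b c) = coc_at a c.
Proof.
move=> ba ca; pose m (d : pointed_plot) := @pt_mor (pp_val a) _ (pp_pt d).
pose Q := pt_plot (pp_val a).
have := coc_mul g (@Simplex2 R X C _ _ _ Q Q Q (m a erefl) (m b ba)
  (m a erefl) (m c ca) (m b ba) (m c ca) Q (mor_id _) (mor_id _) (mor_id _)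
  (fun=> erefl) (fun=> erefl) (fun=> erefl)) pt0.
have eta (d : pointed_plot) : PointedPlot (pp_pt d) = d by case: d.
by rewrite !coc_atE /= !eta.
Qed.

(** The values are those of g on the single 1-simplex with domain V. *)
Lemma coc_at_smooth n (V : domain R n) (P0 P1 : C)
    (F1 : V -> pldom (\val P0)) (F0 : V -> pldom (\val P1)) :
  smooth_dom F1 -> smooth_dom F0 ->
  (forall v, (\val P0) (F1 v) = (\val P1) (F0 v)) ->
  @dsmooth R (dom_space V) G
    (fun v => coc_at (PointedPlot (F1 v)) (PointedPlot (F0 v))).
Proof.
move=> s1 s0 E.
pose Q : plot X := Plot (plots_comp (plot_isplot (\val P0)) s1).
pose m1 : plot_mor Q (\val P0) := @PlotMor _ _ Q _ F1 s1 (fun=> erefl).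
pose m0 : plot_mor Q (\val P1) := @PlotMor _ _ Q _ F0 s0 (fun v => esym (E v)).
have := coc_smooth g (Simplex1 m1 m0).
by congr dsmooth; apply/funext => v; rewrite coc_atE.
Qed.

Lemma base_ex (x : X) : exists a : pointed_plot, pp_val a = x.
Proof.
have [P CP [u ux]] := cgf_cover C x.
by exists (@PointedPlot (SigSub (mem_set CP)) u).
Qed.

(** An arbitrary choice, in general not smooth in x. *)
Definition base (x : X) : pointed_plot := sval (cid (base_ex x)).

Lemma baseP (x : X) : pp_val (base x) = x.
Proof. exact: (svalP (cid (base_ex x))). Qed.

End CocycleValues.

Section CocycleBundle.
Context {R : realType} {X T : diffspace R} {G : diffgroup R}.
Variables (rho : diffaction G T) (C : cgf X) (g : cocycle G C).

(** The identification of the fiber over x, read in the chart at a, with its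
    fixed model T, read in the chart at the base point of x. *)
Definition twist (x : X) (a : pointed_plot C) : diffeo T T :=
  rho (coc_at g (base C x) a).

Lemma twist_mul x (a b : pointed_plot C) t : pp_val a = x -> pp_val b = x ->
  twist x a (rho (coc_at g a b) t) = twist x b t.
Proof.
move=> ax bx; rewrite /twist -(@coc_at_mul _ _ _ _ _ (base C x) a b) ?baseP//.
by rewrite act_mul.
Qed.

(** The T-coordinate of e in the chart at a. *)
Definition coc_coord (e : X * T) (a : pointed_plot C) : T :=
  dinv (twist e.1 a) e.2.

(** The families with a plot as projection and plots as coordinates in all
    charts.  A chart is available only locally in the parameters; allowing any
    smooth change of parameters a, and not only restrictions to open sets, makes
    closure under precomposition immediate. *)
Let coc_plots n : set (param R (X * T) n) :=
  [set p | isplot (param_map fst p) /\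
    forall m (V : domain R m) (a : V -> pdom p) (P : C) (F : V -> pldom (\val P)),
      smooth_dom a -> smooth_dom F ->
      (forall v, (\val P) (F v) = (p (a v)).1) ->
      isplot (Param (fun v => coc_coord (p (a v)) (PointedPlot (F v))))].

(** For a constant family, the base point is a constant point of some member of
    C, so that the coordinates are values of g with one end fixed. *)
Let coc_cover (e : X * T) :
  exists n (p : param R (X * T) n), coc_plots p /\ exists u, p u = e.
Proof.
exists 0%N, (Param (fun _ : pt_dom => e)); split; last by exists pt0.
split=> [|m V a P F sa sF PF]; first exact: plot_cst.
apply: (@plot_dsmooth _ T _ V); apply: (@dsmooth_actV _ (dom_space V)).
  apply: dsmooth_comp (act_smooth rho); rewrite /=.
  have := baseP C e.1; rewrite /pp_val; case: (base C e.1) => P0 u0 /= u0E.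
  apply: coc_at_smooth => //; first exact: smooth_dom_cst.
  by move=> v; rewrite PF.
exact: dsmooth_cst.
Qed.

Let coc_comp n m (p : param R (X * T) n) (V : domain R m) (F : V -> pdom p) :
  coc_plots p -> smooth_dom F -> coc_plots (param_comp F).
Proof.
move=> [p1 p2] sF; split; first exact: (plots_comp p1 sF).
move=> k W a P F' sa sF' E.
exact: (p2 _ _ (F \o a) _ F' (smooth_dom_comp sa sF) sF' E).
Qed.

Let coc_sup n (A : set (param R (X * T) n)) (Q : param R (X * T) n) :
  (forall p, A p -> coc_plots p) -> compatible A -> supremum A Q ->
  coc_plots Q.
Proof.
move=> Ap _ sQ; split.
  apply: plot_local => u; have [p [/Ap[pp _] pu pQ]] := supremum_at (u : pdom Q) sQ.
  by exists (param_map fst p); split=> //; exact: subparam_map.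
move=> m V a P F sa sF E; apply: plot_near => /= v.
have [p [/Ap[_ pp] pu [_ pQ]]] := supremum_at (a v) sQ.
have [W [WV WE]] := smooth_dom_preimage (pdom p) sa.
exists W, WV; split; first exact/WE.
have inp (w : W) : dom_set (pdom p) (\val (a (incl WV w))).
  by apply/WE; exact: set_valP w.
pose a' (w : W) : pdom p := SigSub (mem_set (inp w)).
have sa' : smooth_dom a'.
  have [f cf fE] := smooth_dom_comp (smooth_incl WV) sa.
  by exists f => // w; exact: fE.
have pE w : p (a' w) = Q (a (incl WV w)) by exact: pQ.
have E' w : (\val P) ((F \o incl WV) w) = (p (a' w)).1 by rewrite pE -E.
have := pp _ _ a' P _ sa' (smooth_dom_comp (smooth_incl WV) sF) E'.
by congr isplot; congr Param; apply/funext => w /=; rewrite pE.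
Qed.

Definition coc_total : diffspace R :=
  DiffSpace (Diffeology coc_cover coc_comp coc_sup).

Definition coc_proj (e : coc_total) : X := e.1.

Lemma coc_proj_smooth : dsmooth coc_proj.
Proof. by move=> n p []. Qed.

Definition coc_psi (P : C) (z : prod_space (dom_space (pldom (\val P))) T) :
    coc_total :=
  ((\val P) z.1, twist ((\val P) z.1) (PointedPlot z.1) z.2).

(** In another chart, the coordinate of psi_P(F, t) is obtained from t by a value
    of g: the arbitrary base point cancels, and smoothness of g concludes. *)
Lemma coc_psi_chart (P : C) :
  @chart R (dom_space (pldom (\val P))) T coc_total X (\val P) coc_proj
    (@coc_psi P).
Proof.
split=> // [n p [p1 p2]|u t t' [/(can_inj (dfunK _))]//|Z a e sa se E].
  split; first exact: (plots_comp (plot_isplot (\val P)) p1).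
  move=> m V a P' F sa sF /= E.
  have s1 : smooth_dom (fun v => (p (a v)).1 : pldom (\val P)).
    exact: (smooth_dom_comp sa p1).
  have : @dsmooth R (dom_space V) T (fun v =>
      act rho (coc_at g (PointedPlot (F v)) (PointedPlot (p (a v)).1))
        (p (a v)).2).
    apply: dsmooth_act; last exact: (dsmooth_plot (plots_comp p2 sa)).
    exact: (dsmooth_comp (coc_at_smooth g sF s1 E) (act_smooth rho)).
  move=> /plot_dsmooth; congr isplot; congr Param; apply/funext => v.
  rewrite /coc_coord /coc_psi /=.
  by rewrite -(@twist_mul _ (PointedPlot (F v))) ?dfunK//; exact: E.
exists (fun z => coc_coord (e z) (PointedPlot (a z))) => [n p pp|z].
  have [_ sep] := se _ _ pp.
  apply: (sep _ _ id P (fun v => a (p v))) => //.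
    exact: smooth_dom_id.
  exact: (sa _ _ pp).
rewrite /coc_psi /= E /coc_coord dinvK.
by rewrite /coc_proj; case: (e z).
Qed.

Lemma coc_psi_trans (S : simplex1 C) (r : pldom (s1_Q S)) (t : T) :
  coc_psi (s1_F0 S r, t) = coc_psi (s1_F1 S r, rho (g S r) t).
Proof.
rewrite /coc_psi /= !mor_comm; congr pair; rewrite coc_atE twist_mul//.
all: by rewrite /pp_val /= mor_comm.
Qed.

Definition coc_bundle : gauge_bundle rho X :=
  GaugeBundle coc_proj_smooth (@GaugeStructure _ _ _ rho _ _ coc_proj C coc_psi
    (fun P => proj1 ((chart_pullback _ _ _).1 (coc_psi_chart P)))
    (fun P => proj2 ((chart_pullback _ _ _).1 (coc_psi_chart P)))
    g (coc_smooth g) coc_psi_trans).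

End CocycleBundle.
(** * Isomorphisms and cohomologous cocycles *)

Section Glue.
Context {R : realType} {X T : diffspace R}.

(** A constant family at e lifts through a chart over a plot passing through the
    projection of e. *)
Lemma chart_surj (D : cgf X) (E : diffspace R) (pi : E -> X)
    (chi : forall S : D, prod_space (dom_space (pldom (\val S))) T -> E) e :
  (forall S, @chart R (dom_space (pldom (\val S))) T E X (\val S) pi (chi S)) ->
  exists S z, chi S z = e.
Proof.
move=> ch; have [P DP [u ue]] := cgf_cover D (pi e).
have [_ _ _ lift] := ch (SigSub (mem_set DP)).
have [//|k _ kE] := lift (dom_space (pldom P)) (fun=> u) (fun=> e)
  (@dsmooth_cst _ _ _ _) (@dsmooth_cst _ _ _ _).
exists (SigSub (mem_set DP)); exists (u : pldom P, k u); exact: kE.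
Qed.

(** Compatibility makes the prescription well defined.  It is smooth because
    a plot of E, whose projection factors locally through some member of D, lifts
    locally through the chart over that member. *)
Lemma glue (D : cgf X) (E E' : diffspace R) (pi : E -> X)
    (chi : forall S : D, prod_space (dom_space (pldom (\val S))) T -> E)
    (chi' : forall S : D, prod_space (dom_space (pldom (\val S))) T -> E') :
  dsmooth pi ->
  (forall S, @chart R (dom_space (pldom (\val S))) T E X (\val S) pi (chi S)) ->
  (forall S, dsmooth (chi' S)) ->
  (forall S0 S1 z0 z1, chi S0 z0 = chi S1 z1 -> chi' S0 z0 = chi' S1 z1) ->
  exists2 Phi : E -> E', dsmooth Phi & forall S z, Phi (chi S z) = chi' S z.
Proof.
move=> spi ch sm compat.
have ex e : exists c : {S : D & prod_space (dom_space (pldom (\val S))) T},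
    chi (tag c) (tagged c) = e.
  have [S [z zE]] := chart_surj e ch.
  by exists (Tagged (fun S : D => prod_space (dom_space (pldom (\val S))) T) z).
pose c e := sval (cid (ex e)).
have cE e : chi (tag (c e)) (tagged (c e)) = e := svalP (cid (ex e)).
pose Phi e := chi' (tag (c e)) (tagged (c e)).
have PhiE S z : Phi (chi S z) = chi' S z by apply: compat; exact: cE.
exists Phi => // n p pp; apply: plot_near => /= w.
have [V [VQ [Vw [P DP [F sF FE]]]]] :=
  cgf_near D (w : pdom (param_map pi p)) (spi _ _ pp).
have [_ _ _ lift] := ch (SigSub (mem_set DP)).
have sp := dsmooth_plot (plots_comp pp (smooth_incl VQ)).
have [v|k sk kE] := lift (dom_space V) F _ (dsmooth_dom sF) sp.
  exact/esym/FE.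
exists V, VQ; split=> //.
have := plot_dsmooth (dsmooth_comp
  (dsmooth_pair (dsmooth_dom sF) sk) (sm (SigSub (mem_set DP)))).
congr isplot; congr Param; apply/funext => v.
by have /= <- := congr1 Phi (kE v); rewrite PhiE.
Qed.

Lemma glue_diffeo (D : cgf X) (E E' : diffspace R) (pi : E -> X) (pi' : E' -> X)
    (chi : forall S : D, prod_space (dom_space (pldom (\val S))) T -> E)
    (chi' : forall S : D, prod_space (dom_space (pldom (\val S))) T -> E') :
  dsmooth pi -> dsmooth pi' ->
  (forall S, @chart R (dom_space (pldom (\val S))) T E X (\val S) pi (chi S)) ->
  (forall S, @chart R (dom_space (pldom (\val S))) T E' X (\val S) pi' (chi' S)) ->
  (forall S0 S1 z0 z1, chi S0 z0 = chi S1 z1 <-> chi' S0 z0 = chi' S1 z1) ->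
  exists2 Phi : diffeo E E', (forall e, pi' (Phi e) = pi e) &
    forall S z, Phi (chi S z) = chi' S z.
Proof.
move=> spi spi' ch ch' compat.
have sm S : dsmooth (chi S) by have [] := ch S.
have sm' S : dsmooth (chi' S) by have [] := ch' S.
have [Phi sPhi PhiE] := glue spi ch sm' (fun _ _ _ _ => (compat _ _ _ _).1).
have [Psi sPsi PsiE] := glue spi' ch' sm (fun _ _ _ _ => (compat _ _ _ _).2).
have K : cancel Phi Psi.
  by move=> e; have [S [z <-]] := chart_surj e ch; rewrite PhiE PsiE.
have K' : cancel Psi Phi.
  by move=> e; have [S [z <-]] := chart_surj e ch'; rewrite PsiE PhiE.
exists (Diffeo sPhi sPsi K K') => // e.
have [S [[u t] <-]] := chart_surj e ch; rewrite /= PhiE.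
by have [_ -> _ _] := ch S; have [_ -> _ _] := ch' S.
Qed.

End Glue.

Section Compare.
Context {R : realType} {X T : diffspace R}.
Local Notation G := (Diff_group T).
Local Notation bundle := (gauge_bundle (id_action T) X).

Lemma gs_act_inj (b : bundle) (P : gs_cgf b) (r : pldom (\val P)) (g g' : G) :
  (forall t, gs_psi b P (r, id_action T g t) = gs_psi b P (r, id_action T g' t)) ->
  g = g'.
Proof. exact: (chart_act_inj (gs_chart P)). Qed.

(** Both sides relate the chart over P0 to the chart over P2, and an element of
    Diff(T) is determined by its effect in a chart. *)
Lemma gs_trans_mul (b : bundle) (S : simplex2 (gs_cgf b))
    (r : pldom (s2_Q S)) :
  dg_mul (gs_trans b (face2 S) (s2_F2 S r)) (gs_trans b (face0 S) (s2_F0 S r)) =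
  gs_trans b (face1 S) (s2_F1 S r).
Proof.
apply: (@gs_act_inj b (s2_P0 S) (s2_F12 S (s2_F1 S r))) => t.
rewrite [RHS](esym (gs_transE b (face1 S) _ t)) /= -s2_comm01.
by rewrite (gs_transE b (face0 S)) /= s2_comm02 (gs_transE b (face2 S)) /= s2_comm12.
Qed.

Definition bundle_cocycle (b : bundle) : cocycle G (gs_cgf b) :=
  Cocycle (gs_trans_smooth b) (@gs_trans_mul b).

Lemma gs_chart_pull (b : bundle) (Q : plot X) (P : gs_cgf b)
    (F : plot_mor Q (\val P)) :
  @chart R (dom_space (pldom Q)) T (gb_total b) X Q (@gb_proj _ _ _ _ _ b)
    (fun z => gs_psi b P (F z.1, z.2)).
Proof.
have -> : param_fun Q = (\val P) \o F by apply/funext => r; rewrite /= mor_comm.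
exact: (chart_pull (mor_dsmooth F) (gs_chart P)).
Qed.

(** Over a member of a common refinement, the chart of b carried over by Phi and the
    chart of b' have the same base, so they differ by a map into Diff(T). *)
Lemma diffeo_gauge_iso (b b' : bundle) (Phi : diffeo (gb_total b) (gb_total b')) :
  (forall e, gb_proj (Phi e) = gb_proj e) -> gauge_iso b b'.
Proof.
move=> PhiE; exists Phi; split=> //.
have [D [[l l']]] := common_refinement (gs_cgf b) (gs_cgf b').
exists D, l, l' => S.
have c := chart_diffeo PhiE (gs_chart_pull (ref_mor l S)).
have [h sh hE] := chart_transition (gs_chart_pull (ref_mor l' S)) c.
by exists h.
Qed.

Lemma cech_eqP (C C' : cgf X) (g : cocycle G C) (g' : cocycle G C') :
  cech_eq (Tagged (H1 G) (eclass (@cohomologous _ _ _ C) g))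
          (Tagged (H1 G) (eclass (@cohomologous _ _ _ C') g')) <->
  exists (D : cgf X) (l : refinement C D) (l' : refinement C' D),
    cohomologous (refine_cocycle l g) (refine_cocycle l' g').
Proof.
have coE (D : cgf X) (x y : cocycle G D) := eclass_eqP
  (@cohomologous_refl _ _ _ D) (@cohomologous_sym _ _ _ D)
  (@cohomologous_trans _ _ _ D) x y.
split=> -[D [l [l' H]]]; exists D, l, l'; last first.
  by rewrite /= !H1_refine_eclass; exact/coE.
by move: H; rewrite /= !H1_refine_eclass => /coE.
Qed.

(** Phi applied to a point of E is computed in two charts of b'; the two results
    agree for all t, and the chart of b' can be cancelled. *)
Lemma gauge_iso_cohomologous (b b' : bundle) : gauge_iso b b' ->
  exists (D : cgf X) (l : refinement (gs_cgf b) D) (l' : refinement (gs_cgf b') D),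
    cohomologous (refine_cocycle l (bundle_cocycle b))
                 (refine_cocycle l' (bundle_cocycle b')).
Proof.
move=> [Phi [PhiE [D [l [l' H]]]]]; exists D, l, l'.
exists (fun S => sval (cid (H S))); split=> [S|S r].
  exact: (svalP (cid (H S))).1.
have hE S' := (svalP (cid (H S'))).2.
move: hE; set h := fun S' => sval (cid (H S')) => hE.
apply: (@gs_act_inj b' (l' (s1_P0 S)) (ref_mor l' (s1_P0 S) (s1_F1 S r))) => t.
rewrite [LHS](esym (gs_transE b' (refine_simplex1 l' S) r _)) /=.
rewrite -hE [in LHS](gs_transE b (refine_simplex1 l S) r t).
exact: hE.
Qed.

(** Over S in D, the isomorphism sends the chart of b to the chart of b' twisted by
    h.  Two points of charts with the same image lie over the same point of X,
    hence are the ends of a one-point 1-simplex, and the relation between the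
    cocycles on that simplex is the compatibility required for gluing. *)
Lemma cohomologous_gauge_iso (b b' : bundle) (D : cgf X)
    (l : refinement (gs_cgf b) D) (l' : refinement (gs_cgf b') D) :
  cohomologous (refine_cocycle l (bundle_cocycle b))
               (refine_cocycle l' (bundle_cocycle b')) -> gauge_iso b b'.
Proof.
move=> [h [sh hE]].
pose chi (S : D) (z : prod_space (dom_space (pldom (\val S))) T) :=
  gs_psi b (l S) (ref_mor l S z.1, z.2).
pose chi' (S : D) (z : prod_space (dom_space (pldom (\val S))) T) :=
  gs_psi b' (l' S) (ref_mor l' S z.1, (h S z.1 : diffeo T T) z.2).
have ch S := gs_chart_pull (ref_mor l S).
have ch' S := chart_twist (sh S) (gs_chart_pull (ref_mor l' S)).
suff compat S0 S1 z0 z1 : chi S0 z0 = chi S1 z1 <-> chi' S0 z0 = chi' S1 z1.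
  have [Phi PhiE PhiC] := glue_diffeo (@gb_smooth _ _ _ _ _ b)
    (@gb_smooth _ _ _ _ _ b') ch ch' compat.
  exists Phi; split=> //; exists D, l, l' => S; exists (h S); split=> // r t.
  exact: (PhiC S (r, t)).
case: z0 z1 => [r0 t0] [r1 t1].
(* Rewrites both charts at S1 as charts at S0, with the same fiber coordinate:
   the two cocycles are related by h. *)
have step (e : (\val S1) r1 = (\val S0) r0) :
    exists k : T, chi S1 (r1, t1) = chi S0 (r0, k) /\
                  chi' S1 (r1, t1) = chi' S0 (r0, k).
  pose S := Simplex1 (pt_mor (erefl ((\val S0) r0))) (pt_mor e).
  exists ((bundle_cocycle b (refine_simplex1 l S) pt0 : diffeo T T) t1); split.
    exact: (gs_transE b (refine_simplex1 l S) pt0 t1).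
  have /(congr1 (fun f : diffeo T T => f t1)) /= := hE S pt0.
  rewrite /chi' /= => <-.
  exact: (gs_transE b' (refine_simplex1 l' S) pt0 _).
have [_ c inj _] := ch S0; have [_ c' inj' _] := ch' S0.
have [_ c1 _ _] := ch S1; have [_ c1' _ _] := ch' S1.
split=> e.
  have [|k [E E']] := step.
    by have /= <- := c r0 t0; have /= <- := c1 r1 t1; exact: congr1 (esym e).
  by rewrite E'; move: e; rewrite E => /inj ->.
have [|k [E E']] := step.
  by have /= <- := c' r0 t0; have /= <- := c1' r1 t1; exact: congr1 (esym e).
by rewrite E; move: e; rewrite E' => /inj' ->.
Qed.

End Compare.

(** * The three sets of isomorphism classes *)

Section OverIso.
Context {R : realType} {X : diffspace R}.

Definition over_iso (E E' : diffspace R) (pi : E -> X) (pi' : E' -> X) : Prop :=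
  exists Phi : diffeo E E', forall e, pi' (Phi e) = pi e.

Lemma over_iso_refl (E : diffspace R) (pi : E -> X) : over_iso pi pi.
Proof. by exists (diffeo_id _). Qed.

Lemma over_iso_sym (E E' : diffspace R) (pi : E -> X) (pi' : E' -> X) :
  over_iso pi pi' -> over_iso pi' pi.
Proof.
move=> [Phi PhiE]; exists (Diffeo (dinv_smooth Phi) (dfun_smooth Phi)
  (dinvK Phi) (dfunK Phi)) => e /=.
by rewrite -PhiE dinvK.
Qed.

Lemma over_iso_trans (E1 E2 E3 : diffspace R) (pi1 : E1 -> X) (pi2 : E2 -> X)
    (pi3 : E3 -> X) :
  over_iso pi1 pi2 -> over_iso pi2 pi3 -> over_iso pi1 pi3.
Proof.
move=> [f fE] [g gE].
exists (Diffeo (dsmooth_comp (dfun_smooth f) (dfun_smooth g))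
         (dsmooth_comp (dinv_smooth g) (dinv_smooth f))
         (can_comp (dfunK g) (dfunK f)) (can_comp (dinvK f) (dinvK g))) => e.
by rewrite /= gE fE.
Qed.

End OverIso.

(** Stated on functions between arbitrary types, and not through sets of elements,
    because the classes of bundles live in a universe above that of the
    carriers of diffeological spaces. *)
Lemma inj_surj_bij (A B : Type) (f : A -> B) :
  injective f -> (forall y, exists x, f x = y) -> bijective f.
Proof.
move=> fI fS; have K y := svalP (cid (fS y)).
by exists (fun y => sval (cid (fS y))) => // x; exact/fI/K.
Qed.

Lemma cocycle_eq (R : realType) (X : diffspace R) (G : diffgroup R) (C : cgf X)
    (g g' : cocycle G C) :
  (forall S r, g S r = g' S r) -> g = g'.
Proof.
case: g g' => [g sg mg] [g' sg' mg'] /= gg'.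
have {}gg' : g = g'.
  by apply: functional_extensionality_dep => S; apply/funext => r; exact: gg'.
by subst g'; congr Cocycle; exact: Prop_irrelevance.
Qed.

Section Classes.
Context {R : realType} {X T : diffspace R}.
Local Notation G := (Diff_group T).
Local Notation bundle := (gauge_bundle (id_action T) X).
Local Notation class g := (Tagged (H1 G) (eclass (@cohomologous _ _ _ _) g)).

Lemma gauge_iso_over (b b' : bundle) :
  gauge_iso b b' <->
  over_iso (@gb_proj _ _ _ _ _ b) (@gb_proj _ _ _ _ _ b').
Proof.
by split=> [[Phi [PhiE _]]|[Phi]]; [exists Phi|exact: diffeo_gauge_iso].
Qed.

Lemma cech_eq_over (b b' : bundle) :
  cech_eq (class (bundle_cocycle b)) (class (bundle_cocycle b')) <->
  over_iso (@gb_proj _ _ _ _ _ b) (@gb_proj _ _ _ _ _ b').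
Proof.
rewrite -gauge_iso_over.
split=> [/cech_eqP[D [l [l']]]|]; first exact: cohomologous_gauge_iso.
by move=> /gauge_iso_cohomologous H; exact/cech_eqP.
Qed.

(** Every element of the direct system is represented by the cocycle of a bundle.
    Questions on Cech classes, including whether the relation of the limit is
    an equivalence, thus become questions on bundles. *)
Lemma cech_class_bundle (x : {C : cgf X & H1 G C}) :
  exists b : bundle, x = class (bundle_cocycle b).
Proof.
case: x => C c; exists (coc_bundle (id_action T) (erepr c)).
rewrite -[c in LHS]eclass_repr; congr (class _).
(* The transition maps of the bundle are the cocycle itself. *)
exact: cocycle_eq.
Qed.

Lemma gauge_classP (b b' : bundle) :
  eclass (@gauge_iso _ _ _ _ _) b = eclass (@gauge_iso _ _ _ _ _) b' <->
  over_iso (@gb_proj _ _ _ _ _ b) (@gb_proj _ _ _ _ _ b').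
Proof.
rewrite eclass_eqP; first exact: gauge_iso_over.
- by move=> x; apply/gauge_iso_over; exact: over_iso_refl.
- by move=> x y /gauge_iso_over/over_iso_sym/gauge_iso_over.
- move=> x y z /gauge_iso_over xy /gauge_iso_over yz; apply/gauge_iso_over.
  exact: over_iso_trans xy yz.
Qed.

Lemma cech_classP (b b' : bundle) :
  cech_class (bundle_cocycle b) = cech_class (bundle_cocycle b') <->
  over_iso (@gb_proj _ _ _ _ _ b) (@gb_proj _ _ _ _ _ b').
Proof.
rewrite eclass_eqP; first exact: cech_eq_over.
- move=> x; have [a ->] := cech_class_bundle x; apply/cech_eq_over.
  exact: over_iso_refl.
- move=> x y; have [a ->] := cech_class_bundle x.
  have [a' ->] := cech_class_bundle y.
  by move=> /cech_eq_over/over_iso_sym/cech_eq_over.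
- move=> x y z; have [a ->] := cech_class_bundle x.
  have [a' ->] := cech_class_bundle y; have [a2 ->] := cech_class_bundle z.
  move=> /cech_eq_over xy /cech_eq_over yz; apply/cech_eq_over.
  exact: over_iso_trans xy yz.
Qed.

Lemma fiber_classP (b b' : fiber_bundle T X) :
  eclass (@fiber_iso _ _ _) b = eclass (@fiber_iso _ _ _) b' <->
  over_iso (@fb_proj _ _ _ b) (@fb_proj _ _ _ b').
Proof.
rewrite eclass_eqP //.
- by move=> x; exact: over_iso_refl.
- by move=> x y; exact: over_iso_sym.
- by move=> x y z; exact: over_iso_trans.
Qed.

End Classes.

Theorem proposition6p10 (R : realType) (X T : diffspace R) :
  [/\ (inhabited X -> inhabited T) ->
        forall (E : diffspace R) (pi : E -> X),
          is_gauge_bundle (id_action T) pi <-> is_fiber_bundle T pi,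
      exists f : Bund (id_action T) X -> cech_H1 X (Diff_group T),
        bijective f /\
        forall (b : gauge_bundle (id_action T) X)
               (g : cocycle (Diff_group T) (gs_cgf b)),
          (forall S r, g S r = gs_trans b S r) ->
          f (eclass _ b) = cech_class g
    & (inhabited X -> inhabited T) ->
      exists f : Bund (id_action T) X -> Bund_fiber X T,
        bijective f /\
        forall (b : gauge_bundle (id_action T) X)
               (H : is_fiber_bundle T (@gb_proj _ _ _ _ _ b)),
          f (eclass _ b) = eclass _ (FiberBundle H) ].
Proof.
split=> [XT E pi||XT].
- by split; [exact: gauge_fiber|exact: fiber_gauge].
- pose f (c : Bund (id_action T) X) := cech_class (bundle_cocycle (erepr c)).
  have fE b : f (eclass _ b) = cech_class (bundle_cocycle b).
    by apply/cech_classP/gauge_classP; exact: eclass_repr.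
  exists f; split=> [|b g gE].
    apply: inj_surj_bij => [c c' /cech_classP/gauge_classP|y].
      by rewrite !eclass_repr.
    have [b yE] := cech_class_bundle (erepr y).
    by exists (eclass _ b); rewrite fE -(eclass_repr y) yE.
  by rewrite fE; congr cech_class; apply: cocycle_eq => S r; rewrite gE.
- have fib (b : gauge_bundle (id_action T) X) :
      is_fiber_bundle T (@gb_proj _ _ _ _ _ b).
    by apply: (gauge_fiber XT); split; [exact: gb_smooth|exact: (inhabits (gb_struct b))].
  pose f (c : Bund (id_action T) X) : Bund_fiber X T :=
    eclass (@fiber_iso _ _ _) (FiberBundle (fib (erepr c))).
  have fE b H : f (eclass _ b) =
      eclass (@fiber_iso _ _ _) (@FiberBundle _ _ _ _ (@gb_proj _ _ _ _ _ b) H).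
    by apply/fiber_classP/(gauge_classP (erepr _) b)/eclass_repr.
  exists f; split=> //; apply: inj_surj_bij => [c c' /fiber_classP cc'|y].
    by have := (gauge_classP (erepr c) (erepr c')).2 cc'; rewrite !eclass_repr.
  case E: (erepr y) => [F p bp]; have [sp [s]] := fiber_gauge bp.
  exists (eclass _ (GaugeBundle sp s)).
  by rewrite (fE (GaugeBundle sp s) bp) -(eclass_repr y) E.
Qed.
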